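(* Let $\mathfrak{n}$ be a filiform Lie algebra (finite-dimensional over $\mathbb{C}$) of rank one, and put $n=\dim\mathfrak{n}$. Then $\mathfrak{n}$ is completable if and only if $\mathfrak{n}$ is isomorphic to an algebra $A_{n}^{k}(\lambda_{1},\dots,\lambda_{t-1})$ or to an algebra $B_{n}^{k}(\lambda_{1},\dots,\lambda_{t-1})$, for some admissible $k$ and parameters $\lambda_i$ (these families are defined in the context).
   Context: All Lie algebras are finite-dimensional over $\mathbb{C}$. Complete: a Lie algebra $\mathfrak{g}$ is complete if $H^{0}(\mathfrak{g},\mathfrak{g})=H^{1}(\mathfrak{g},\mathfrak{g})=\{0\}$ (adjoint cohomology), i.e. its center is zero and every derivation is inner. Torus, rank, completable: for a nilpotent Lie algebra $\mathfrak{n}$, a maximal torus $\mathfrak{t}\subset \mathrm{Der}(\mathfrak{n})$ is an abelian subalgebra consisting of semisimple (diagonalizable) derivations that is maximal for inclusion among such subalgebras. The rank of $\mathfrak{n}$ is $\dim\mathfrak{t}$. The algebra $\mathfrak{n}$ is completable if the semidirect product $\mathfrak{n}\oplus\mathfrak{t}$ (with $[h,X]=h(X)$ for $h\in\mathfrak{t}$, $X\in\mathfrak{n}$) is complete, where $\mathfrak{t}$ is a maximal torus of derivations of $\mathfrak{n}$. Filiform: for $Y\in\mathfrak{n}\setminus[\mathfrak{n},\mathfrak{n}]$ let $c(Y)$ be the non-increasing sequence of sizes of the Jordan blocks of the nilpotent operator $\mathrm{ad}\,Y$; the characteristic sequence $c(\mathfrak{n})$ is the maximum of the $c(Y)$ in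 lexicographic order. An $n$-dimensional nilpotent Lie algebra is filiform if $c(\mathfrak{n})=(n-1,1)$. Families (basis $Y_1,\dots,Y_n$; brackets not listed and not following by antisymmetry are zero; $[x]$ denotes the integer part of $x$): $A_{n}^{k}(\lambda_{1},\dots,\lambda_{t-1})$, where $2\le k\le n-3$ and $t=\left[\frac{n-k+1}{2}\right]$: - $[Y_1,Y_i]=Y_{i+1}$ for $i=2,\dots,n-1$; - $[Y_i,Y_{i+1}]=\lambda_{i-1}Y_{2i+k-1}$ for $2\le i\le t$; - $[Y_i,Y_j]=a_{ij}Y_{i+j+k-2}$ for $2\le i\le j$, $i+j+k-2\le n$. $B_{n}^{k}(\lambda_{1},\dots,\lambda_{t-1})$, where $n=2m$ is even, $2\le k\le n-3$ and $t=\left[\frac{n-k}{2}\right]$: - $[Y_1,Y_i]=Y_{i+1}$ for $i=2,\dots,n-2$; - $[Y_i,Y_{n-i+1}]=(-1)^{i+1}Y_n$ for $i=2,\dots,n-1$; - $[Y_i,Y_{i+1}]=\lambda_{i-1}Y_{2i+k-1}$ for $i=2,\dots,t$; - $[Y_i,Y_j]=a_{ij}Y_{i+j+k-2}$ for $2\le i,j\le n-2$, $i+j+k-2\le n-1$, $j\ne i+1$. In both families the $\lambda_i\in\mathbb{C}$ are not all zero and satisfy the polynomial equations expressing the Jacobi identity, and the constants $a_{ij}$ (antisymmetric in $i,j$) satisfy $a_{ij}=a_{i,j+1}+a_{i+1,j}$ (whenever the constants involved occur) and $a_{i,i+1}=\lambda_{i-1}$. *)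

(* Defs.v *)
From HB Require Import structures.
From mathcomp Require Import all_boot all_order all_algebra.
From mathcomp Require Export complex.
From mathcomp Require Export reals.

Set Implicit Arguments.
Unset Strict Implicit.
Unset Printing Implicit Defensive.

Import Order.TTheory GRing.Theory.
Local Open Scope ring_scope.

HB.mixin Record Vector_hasLieBracket (K : fieldType) (L : Type)
    of Vector K L := {
  lie_bracket : L -> L -> L;
  lie_linearl : forall y, linear (lie_bracket^~ y);
  lie_linearr : forall x, linear (lie_bracket x);
  liexx : forall x, lie_bracket x x = 0;
  lie_jacobi : forall x y z,
    lie_bracket x (lie_bracket y z) + lie_bracket y (lie_bracket z x)
      + lie_bracket z (lie_bracket x y) = 0
}.

#[short(type="lieAlgType")]
HB.structure Definition LieAlgebra (K : fieldType) :=
  { L of Vector K L & Vector_hasLieBracket K L }.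

Notation "[ 'lie' x , y ]" := (lie_bracket x y)
  (at level 0, x, y at level 99, format "[ 'lie'  x ,  y ]") : ring_scope.

Section LieTheory.
Variables (K : fieldType) (L : lieAlgType K).
Implicit Types (x y z : L) (D f : 'End(L)).

HB.instance Definition _ x :=
  GRing.isLinear.Build K L L *:%R (lie_bracket x) (lie_linearr x).

Definition ad x : 'End(L) := linfun (lie_bracket x).

Lemma adE x y : ad x y = [lie x, y].
Proof. exact: lfunE. Qed.

(* Brackets of basis vectors suffice, by bilinearity. *)
Definition lie_prodv (U V : {vspace L}) : {vspace L} :=
  <<[seq [lie x, y] | x <- vbasis U, y <- vbasis V]>>%VS.

Definition derived_algebra : {vspace L} := lie_prodv fullv fullv.

Definition lower_central (m : nat) : {vspace L} :=
  iter m (lie_prodv fullv) fullv.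

Definition lie_nilpotent : Prop := exists m, lower_central m = 0%VS.

Definition is_derivation D : Prop :=
  forall x y, D [lie x, y] = [lie D x, y] + [lie x, D y].

(* H^0(L, L) = 0 and H^1(L, L) = 0, respectively. *)
Definition complete : Prop :=
  (forall x, (forall y, [lie x, y] = 0) -> x = 0) /\
  (forall D, is_derivation D -> exists x, D = ad x).

End LieTheory.

Definition isomorphic (K : fieldType) (L M : lieAlgType K) : Prop :=
  exists phi : 'Hom(L, M),
    bijective phi /\ forall x y, phi [lie x, y] = [lie phi x, phi y].

Section CharacteristicSequence.
Variable K : fieldType.

(* s is the sequence of sizes of the Jordan blocks of the nilpotent operator f,
   in non-increasing order: V has a basis made of chains x, f x, ...,
   f^(p-1) x with f^p x = 0, one for each entry p of s; in the basis formed by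
   such a chain f acts by the nilpotent Jordan block of size p. *)
Definition nilp_jordan_sizes (V : vectType K) (f : 'End(V)) (s : seq nat) :
    Prop :=
  [/\ sorted geq s, 0%N \notin s &
    exists xs : seq V,
      [/\ size xs = size s,
          basis_of fullv (flatten [seq traject f xp.1 xp.2 | xp <- zip xs s]) &
          forall xp, xp \in zip xs s -> iter xp.2 f xp.1 = 0]].

Definition characteristic_sequence (L : lieAlgType K) (s : seq nat) : Prop :=
  (exists2 Y : L, Y \notin derived_algebra L & nilp_jordan_sizes (ad Y) s) /\
  (forall (Y : L) (s' : seq nat), Y \notin derived_algebra L ->
     nilp_jordan_sizes (ad Y) s' -> ((s' : seqlexi nat) <= s)%O).

Definition filiform (L : lieAlgType K) : Prop :=
  lie_nilpotent L /\
  characteristic_sequence L [:: (\dim {:L} - 1)%N; 1%N].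

End CharacteristicSequence.

Section Torus.
Variables (K : fieldType) (L : lieAlgType K).

Definition diagonalizable_end (f : 'End(L)) : Prop :=
  exists2 b : seq L, basis_of fullv b &
    forall v, v \in b -> exists a : K, f v = a *: v.

(* An abelian subalgebra of Der(L) is a subspace of pairwise commuting
   derivations. *)
Record torus := Torus {
  torus_space :> {vspace 'End(L)};
  torus_der : forall f, f \in torus_space -> is_derivation f;
  torus_diag : forall f, f \in torus_space -> diagonalizable_end f;
  torus_comm : forall f g, f \in torus_space -> g \in torus_space ->
    (f \o g)%VF = (g \o f)%VF
}.

Definition maximal_torus (t : torus) : Prop :=
  forall t' : torus, (t <= t')%VS -> torus_space t' = t.

(* Maximal tori are conjugate under automorphisms, so neither the rank nor
   completability depends on the maximal torus. *)
Definition has_rank (r : nat) : Prop :=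
  exists2 t : torus, maximal_torus t & \dim t = r.

End Torus.

Definition semidirect (K : fieldType) (L : lieAlgType K) (t : torus L) : Type :=
  (L * subvs_of t)%type.

Section Semidirect.
Variables (K : fieldType) (L : lieAlgType K) (t : torus L).

HB.instance Definition _ := Vector.copy (semidirect t) (L * subvs_of t)%type.

(* [X + h, Y + g] = [X, Y] + h(Y) - g(X); the component [h, g] along the
   abelian algebra t vanishes. *)
Definition semidirect_bracket (u v : semidirect t) : semidirect t :=
  ([lie u.1, v.1] + vsval u.2 v.1 - vsval v.2 u.1, 0).

Let lieDl (x y z : L) : [lie x + y, z] = [lie x, z] + [lie y, z].
Proof. by have := lie_linearl z 1 x y; rewrite !scale1r. Qed.

Let lieDr (x y z : L) : [lie z, x + y] = [lie z, x] + [lie z, y].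
Proof. exact: raddfD. Qed.

Let lieNr (x z : L) : [lie z, - x] = - [lie z, x].
Proof. exact: raddfN. Qed.

Let lieC (x y : L) : [lie x, y] = - [lie y, x].
Proof.
have := liexx (x + y); rewrite lieDl !lieDr !liexx add0r addr0.
by move/eqP; rewrite addr_eq0 => /eqP.
Qed.

Fact semidirect_linearr u : linear (semidirect_bracket u).
Proof.
move=> a v w; congr pair => /=; last by rewrite scaler0 addr0.
rewrite !linearP /= add_lfunE scale_lfunE /=.
by rewrite !scalerDr scalerN opprD [in RHS]addrACA; congr (_ + _); rewrite addrACA.
Qed.

Fact semidirect_bracketC u v :
  semidirect_bracket u v = - semidirect_bracket v u.
Proof.
congr pair => /=; last by rewrite oppr0.
by rewrite lieC !opprD opprK addrAC.
Qed.

Fact semidirect_linearl v : linear (semidirect_bracket^~ v).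
Proof.
move=> a u w; rewrite semidirect_bracketC semidirect_linearr.
by rewrite opprD -scalerN -!semidirect_bracketC.
Qed.

Fact semidirect_xx u : semidirect_bracket u u = 0.
Proof. by congr pair; rewrite /= liexx add0r subrr. Qed.

Fact semidirect_jacobi u v w :
  semidirect_bracket u (semidirect_bracket v w)
  + semidirect_bracket v (semidirect_bracket w u)
  + semidirect_bracket w (semidirect_bracket u v) = 0.
Proof.
have Hd (h : subvs_of t) x y := torus_der (subvsP h) x y.
have Hc (h g : subvs_of t) x : vsval h (vsval g x) = vsval g (vsval h x).
  have := torus_comm (subvsP h) (subvsP g).
  by move/(congr1 (fun f : 'End(L) => f x)); rewrite !comp_lfunE.
case: u v w => [x f] [y g] [z h]; congr pair => /=; last by rewrite !addr0.
rewrite !zero_lfunE !subr0.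
rewrite !(lieDr, linearD, linearN, lieNr) /= !Hd.
rewrite (Hc g f) (Hc h f) (Hc h g).
rewrite (lieC (vsval f y) z) (lieC (vsval g z) x) (lieC (vsval h x) y).
rewrite !addrA.
rewrite (ACl (1*8*15*(2*11)*(3*19)*(4*16)*(5*10)*(6*14)*(7*20)*(9*18)*(12*17)
  *(13*21))).
by rewrite /= lie_jacobi !(subrr, addNr) !addr0.
Qed.

HB.instance Definition _ :=
  Vector_hasLieBracket.Build K (semidirect t) semidirect_linearl
    semidirect_linearr semidirect_xx semidirect_jacobi.

End Semidirect.

Definition completable (K : fieldType) (L : lieAlgType K) : Prop :=
  exists2 t : torus L, maximal_torus t & complete (semidirect t).

Section StructureConstants.
Variables (K : fieldType) (n : nat).

(* The bilinear product on K^n sending the i-th and j-th basis vectors to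
   c i j. *)
Definition sc_bracket (c : 'I_n -> 'I_n -> 'rV[K]_n) (x y : 'rV[K]_n) :
    'rV[K]_n :=
  \sum_i \sum_j (x 0 i * y 0 j) *: c i j.

Record lieConst := LieConst {
  lie_const :> 'I_n -> 'I_n -> 'rV[K]_n;
  lie_const_diag : forall i, lie_const i i = 0;
  lie_const_anti : forall i j, lie_const j i = - lie_const i j;
  lie_const_jacobi : forall i j l,
    sc_bracket lie_const (delta_mx 0 i) (lie_const j l)
    + sc_bracket lie_const (delta_mx 0 j) (lie_const l i)
    + sc_bracket lie_const (delta_mx 0 l) (lie_const i j) = 0
}.

Definition lie_of (c : lieConst) : Type := 'rV[K]_n.

Variable c : lieConst.

HB.instance Definition _ := Vector.copy (lie_of c) 'rV[K]_n.

Fact sc_bracket_linearr (x : lie_of c) : linear (sc_bracket c x).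
Proof.
move=> a y z; rewrite /sc_bracket scaler_sumr -big_split; apply: eq_bigr => i _.
rewrite scaler_sumr -big_split; apply: eq_bigr => j _ /=.
by rewrite !mxE mulrDr scalerDl scalerA mulrCA.
Qed.

Fact sc_bracket_linearl (y : lie_of c) : linear (sc_bracket c ^~ y).
Proof.
move=> a x z; rewrite /sc_bracket scaler_sumr -big_split; apply: eq_bigr => i _.
rewrite scaler_sumr -big_split; apply: eq_bigr => j _ /=.
by rewrite !mxE mulrDl scalerDl scalerA mulrA.
Qed.

Lemma sc_bracket_delta i j :
  sc_bracket c (delta_mx 0 i) (delta_mx 0 j) = c i j.
Proof.
rewrite /sc_bracket (bigD1 i) //= [X in _ + X]big1 => [|i' ne_i]; last first.
  by rewrite big1 // => j' _; rewrite !mxE (negPf ne_i) mul0r scale0r.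
rewrite (bigD1 j) //= big1 => [|j' ne_j]; last first.
  by rewrite !mxE (negPf ne_j) mulr0 scale0r.
by rewrite !mxE !eqxx mulr1 scale1r !addr0.
Qed.

Fact sc_bracket_xx (x : lie_of c) : sc_bracket c x x = 0.
Proof.
pose F (i j : 'I_n) := (x 0 i * x 0 j) *: c i j.
have FC i j : F j i = - F i j by rewrite /F lie_const_anti scalerN mulrC.
transitivity (\sum_(i < n) (\sum_(j < n | (i < j)%N) F i j
  + \sum_(j < n | ~~ (i < j)%N) F i j)).
  by apply: eq_bigr => i _; rewrite (bigID (fun j : 'I_n => (i < j)%N)).
rewrite big_split /= [X in _ + X](exchange_big_dep predT) //= -big_split /=.
apply: big1 => i _; rewrite [X in _ + X](bigD1 i) ?ltnn //=.
rewrite {2}/F lie_const_diag scaler0 add0r.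
rewrite [X in _ + X](eq_big (fun j : 'I_n => (i < j)%N) (fun j => - F i j)).
- by rewrite sumrN subrr.
- by move=> j; rewrite -leqNgt ltn_neqAle andbC eq_sym.
- by move=> j _; rewrite FC.
Qed.

Let sc_bracket3E (x y z : lie_of c) :
  sc_bracket c x (sc_bracket c y z) =
  \sum_i \sum_j \sum_l (x 0 i * y 0 j * z 0 l) *:
     sc_bracket c (delta_mx 0 i) (c j l).
Proof.
have rowE v : sc_bracket c x v = \sum_i x 0 i *: sc_bracket c (delta_mx 0 i) v.
  rewrite {1}/sc_bracket; apply: eq_bigr => i _.
  rewrite /sc_bracket [in RHS](bigD1 i) //= [X in _ = _ *: (_ + X)]big1.
    rewrite addr0 scaler_sumr; apply: eq_bigr => j _.
    by rewrite scalerA !mxE !eqxx mul1r.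
  move=> i' ne_i; rewrite big1 // => j' _.
  by rewrite !mxE (negPf ne_i) mul0r scale0r.
rewrite rowE; apply: eq_bigr => i _.
set T := sc_bracket c (delta_mx 0 i).
have T0 : T 0 = 0.
  rewrite /T /sc_bracket big1 // => i' _; rewrite big1 // => j' _.
  by rewrite [(0 : 'rV_n) _ _]mxE mulr0 scale0r.
have TD : {morph T : u v / u + v}.
  move=> u v; have := sc_bracket_linearr (delta_mx 0 i) 1 u v.
  by rewrite !scale1r.
have TZ a u : T (a *: u) = a *: T u.
  by have := sc_bracket_linearr (delta_mx 0 i) a u 0; rewrite -/T T0 !addr0.
rewrite {1}/sc_bracket (big_morph T TD T0) scaler_sumr; apply: eq_bigr => j _.
rewrite (big_morph T TD T0) scaler_sumr; apply: eq_bigr => l _.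
by rewrite TZ scalerA mulrA.
Qed.

Fact sc_bracket_jacobi (x y z : lie_of c) :
  sc_bracket c x (sc_bracket c y z) + sc_bracket c y (sc_bracket c z x)
  + sc_bracket c z (sc_bracket c x y) = 0.
Proof.
rewrite !sc_bracket3E.
have rot (G : 'I_n -> 'I_n -> 'I_n -> lie_of c) :
    \sum_j \sum_l \sum_i G j l i = \sum_i \sum_j \sum_l G j l i.
  rewrite [RHS]exchange_big; apply: eq_bigr => j _.
  by rewrite [RHS]exchange_big.
rewrite [X in _ + X + _]rot [X in _ + _ + X]rot [X in _ + _ + X]rot.
rewrite -!big_split /= big1 // => i _; rewrite -!big_split /= big1 // => j _.
rewrite -!big_split /= big1 // => l _.
have -> : y 0 j * z 0 l * x 0 i = x 0 i * y 0 j * z 0 l by rewrite mulrC mulrA.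
have -> : z 0 l * x 0 i * y 0 j = x 0 i * y 0 j * z 0 l by rewrite -mulrA mulrC.
by rewrite -!scalerDr lie_const_jacobi scaler0.
Qed.

HB.instance Definition _ :=
  Vector_hasLieBracket.Build K (lie_of c) sc_bracket_linearl
    sc_bracket_linearr sc_bracket_xx sc_bracket_jacobi.

End StructureConstants.

Section Families.
Variables (K : fieldType) (n k : nat).

(* The basis vector Y_m of K^n, for 1 <= m <= n. *)
Definition Y (m : nat) : 'rV[K]_n := \row_(j < n) (j.+1 == m)%:R.

Definition A_t : nat := (n - k + 1)./2.

Definition A_bracket (a : nat -> nat -> K) (i j : nat) : 'rV[K]_n :=
  if i == 1%N then if (2 <= j <= n - 1)%N then Y j.+1 else 0
  else if j == 1%N then if (2 <= i <= n - 1)%N then - Y i.+1 else 0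
  else if (i + j + k - 2 <= n)%N then a i j *: Y (i + j + k - 2) else 0.

(* c is the table of structure constants of A_n^k(lam), where lambda_i is the
   entry of index i - 1 of lam.  The values of a at the indices i, j >= 2 with
   i + j + k - 2 <= n are determined by lam; the others are not used.  The
   brackets [Y_i, Y_(i+1)] = lambda_(i-1) Y_(2i+k-1) are covered by A_bracket,
   since a i i.+1 = lambda_(i-1).  The Jacobi equations on lam hold because c
   is a lieConst. *)
Definition is_A (lam : (A_t - 1).-tuple K) (c : lieConst K n) : Prop :=
  [/\ (2 <= k <= n - 3)%N,
      exists2 x, x \in lam & x != 0 &
      exists a : nat -> nat -> K,
        [/\ forall i j, a j i = - a i j,
            forall i, (2 <= i <= A_t)%N -> a i i.+1 = lam`_(i - 2),
            forall i j, (2 <= i)%N -> (2 <= j)%N ->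
              (i + j.+1 + k - 2 <= n)%N -> a i j = a i j.+1 + a i.+1 j &
            forall i j : 'I_n, c i j = A_bracket a i.+1 j.+1]].

Definition B_t : nat := (n - k)./2.

(* In the last case i, j <= n - 2 holds automatically, as k >= 2. *)
Definition B_bracket (a : nat -> nat -> K) (i j : nat) : 'rV[K]_n :=
  if i == 1%N then if (2 <= j <= n - 2)%N then Y j.+1 else 0
  else if j == 1%N then if (2 <= i <= n - 2)%N then - Y i.+1 else 0
  else if (i + j == n.+1)%N then (-1) ^+ i.+1 *: Y n
  else if (i + j + k - 2 <= n - 1)%N then a i j *: Y (i + j + k - 2) else 0.

Definition is_B (lam : (B_t - 1).-tuple K) (c : lieConst K n) : Prop :=
  [/\ ~~ odd n, (2 <= k <= n - 3)%N,
      exists2 x, x \in lam & x != 0 &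
      exists a : nat -> nat -> K,
        [/\ forall i j, a j i = - a i j,
            forall i, (2 <= i <= B_t)%N -> a i i.+1 = lam`_(i - 2),
            forall i j, (2 <= i)%N -> (2 <= j)%N ->
              (i + j.+1 + k - 2 <= n - 1)%N -> a i j = a i j.+1 + a i.+1 j &
            forall i j : 'I_n, c i j = B_bracket a i.+1 j.+1]].

End Families.

Arguments Y {K n} m.
Arguments A_bracket {K n} k a i j.
Arguments B_bracket {K n} k a i j.
Arguments is_A {K n} k lam c.
Arguments is_B {K n} k lam c.

(* Main.v *)
(* Let h span the given maximal torus, and let G_1 > G_2 > ... be the lower
   central series, whose successive quotients past the first are lines.  An
   element u "kills m" when it acts as zero from G_m/G_(m+1) to G_(m+1)/G_(m+2).
   The elements killing m form an h-stable hyperplane containing G_1, and by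
   Vergne's argument (Jacobi) this hyperplane is the same for all m up to n - 4.
   Diagonalizability of h then yields homogeneous generators U, Z such that Z
   kills all these m, and the chain Z, [U, Z], [U, [U, Z]], ... gives a
   homogeneous basis; only the step m = n - 3 separates the two types A and B.
   If a and b are the weights of U and Z, the rank-one hypothesis excludes the
   models L_n and Q_n, which carry a second diagonal derivation.  This forces
   a <> 0 and b = k a with k >= 2, so that the brackets are those of A_n^k or
   B_n^k.  The weights are then nonzero and pairwise distinct, so a derivation
   of the semidirect product can be corrected by an inner one until it commutes
   with h, hence is diagonal, hence lies in the torus by maximality.  Thus every
   rank-one filiform algebra is both completable and isomorphic to a member of
   the two families. *)

From HB Require Import structures.
Require Import Defs.
From mathcomp Require Import all_boot all_order all_algebra.
From mathcomp Require Import complex reals.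
From mathcomp Require Import zify ring.

Set Implicit Arguments.
Unset Strict Implicit.
Unset Printing Implicit Defensive.

Import Order.TTheory GRing.Theory passmx.
Local Open Scope ring_scope.

#[local] Arguments lower_central : simpl never.

(** * Eigenvectors and flags *)

Section LinearAlgebra.
Variables (K : fieldType) (V : vectType K).
Implicit Types (U W : {vspace V}) (f : 'End(V)).

Lemma mem_codim1 U W v u : (W <= U)%VS -> (\dim U <= (\dim W).+1)%N ->
  v \in U -> v \notin W -> u \in U -> exists c, u - c *: v \in W.
Proof.
move=> sWU dUW Uv W'v Uu.
have W0 : (<[v]> :&: W = 0)%VS.
  apply/eqP; rewrite -subv0; apply/subvP => x /memv_capP[/vlineP[k ->]].
  have [->|k0] := eqVneq k 0; first by rewrite scale0r !mem0v.
  move=> Wkv; case/negP: W'v.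
  by have := memvZ k^-1 Wkv; rewrite scalerA mulVf // scale1r.
have v0 : v != 0 by apply: contraNneq W'v => ->; rewrite mem0v.
have dS : \dim (<[v]> + W) = (\dim W).+1.
  by rewrite dimv_disjoint_sum // dim_vline v0.
have sU : (<[v]> + W <= U)%VS by rewrite subv_add sWU andbT -memvE.
have /eqP eU : (<[v]> + W == U)%VS by rewrite eqEdim sU dS.
move: Uu; rewrite -eU; case/memv_addP => x /vlineP[c ->] [y Wy ->]; exists c.
by rewrite addrC addKr.
Qed.

Lemma dim_codim1 U W v : v \in U ->
  (forall u, u \in U -> exists c, u - c *: v \in W) ->
  (\dim U <= (\dim W).+1)%N.
Proof.
move=> Uv dec; have sU : (U <= <[v]> + W)%VS.
  apply/subvP => u Uu; have [c Wc] := dec u Uu.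
  by rewrite -(subrK (c *: v) u) addrC memv_add // memvZ // memv_line.
apply: leq_trans (dimvS sU) _; apply: leq_trans (dimv_add_leqif _ _) _.
by rewrite dim_vline -addn1 addnC leq_add2l leq_b1.
Qed.

(** Going up from the zero end of the flag, each [F i] lies in the span because one step adds only
    the line of [E i]; a spanning family of [n] vectors is a basis. *)
Lemma basis_of_flag (F : nat -> {vspace V}) (E : nat -> V) n :
  n = \dim {:V} -> F 0 = fullv -> F n = 0%VS ->
  (forall i, (i < n)%N -> (F i.+1 <= F i)%VS) ->
  (forall i, (i < n)%N -> (\dim (F i) <= (\dim (F i.+1)).+1)%N) ->
  (forall i, (i < n)%N -> E i \in F i) ->
  (forall i, (i < n)%N -> E i \notin F i.+1) ->
  basis_of fullv [seq E i | i <- iota 0 n].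
Proof.
move=> defn F0 Fn sF dF EF E'F.
rewrite basisEdim size_map size_iota -defn leqnn andbT -F0.
suff span i : (i <= n)%N -> (F i <= <<[seq E i | i <- iota 0 n]>>)%VS.
  exact: span.
move=> le_in; rewrite -(subKn le_in); move: (n - i)%N (leq_subr i n) =>
  {i le_in} j.
elim: j => [_ | j IHj lt_jn]; first by rewrite subn0 Fn sub0v.
have lt_i : (n - j.+1 < n)%N by rewrite ltn_subrL; case: (n) lt_jn.
have Si : (n - j.+1).+1 = (n - j)%N by lia.
apply/subvP => x Fx; have :=
  mem_codim1 (sF _ lt_i) (dF _ lt_i) (EF _ lt_i) (E'F _ lt_i) Fx.
rewrite Si => -[c Fc]; rewrite -(subrK (c *: E (n - j.+1)%N) x) memvD //.
  by apply: (subvP (IHj _)) => //; apply: ltnW.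
by rewrite memvZ // memv_span // map_f // mem_iota.
Qed.

Definition eigenvect f a v := f v = a *: v.

(** Applying [f] minus its first eigenvalue to the sum removes one summand and multiplies the others
    by nonzero scalars. Induction puts those in [W], and the removed one follows by difference. *)
Lemma stable_eigen_sum f W n (v : 'I_n -> V) (a : 'I_n -> K) :
  (forall x, x \in W -> f x \in W) ->
  (forall i, eigenvect f (a i) (v i)) -> injective a ->
  \sum_i v i \in W -> forall i, v i \in W.
Proof.
move=> sW; elim: n => [|n IHn] in v a * => ev inj_a sumW; first by case.
pose b i := (a (lift ord0 i) - a ord0) *: v (lift ord0 i).
have bW : \sum_i b i \in W.
  have := memvB (sW _ sumW) (memvZ (a ord0) sumW).
  rewrite linear_sum /= scaler_sumr -sumrB big_ord_recl ev subrr add0r.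
  by rewrite (eq_bigr b) // => i _; rewrite ev -scalerBl.
have lW i : v (lift ord0 i) \in W.
  have nz : a (lift ord0 i) - a ord0 != 0.
    by rewrite subr_eq0; apply/eqP => /inj_a/eqP;
      rewrite eq_sym (negPf (neq_lift _ _)).
  suff bi : b i \in W.
    have := memvZ (a (lift ord0 i) - a ord0)^-1 bi.
    by rewrite /b scalerA mulVf // scale1r.
  apply: (IHn b (fun i => a (lift ord0 i))) => // [j|j k /inj_a/lift_inj//].
  by rewrite /b /eigenvect linearZ /= ev !scalerA mulrC.
move=> i; case: (unliftP ord0 i) => [j ->|->] //.
rewrite big_ord_recl in sumW.
have: \sum_j v (lift ord0 j) \in W by apply: memv_suml => j _; apply: lW.
by move=> /(memvB sumW); rewrite addrK.
Qed.

(** The condition [diagonalizable_end], stated for a bare vector space. *)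
Definition has_eigenbasis f :=
  exists2 b : seq V, basis_of fullv b &
    forall v, v \in b -> exists a : K, f v = a *: v.

Lemma eigen_decomp f v : has_eigenbasis f ->
  exists n (u : 'I_n -> V) (a : 'I_n -> K),
  [/\ injective a, forall i, eigenvect f (a i) (u i) & v = \sum_i u i].
Proof.
case=> b basb eigb.
have: v \in <<b>>%VS by rewrite (span_basis basb) memvf.
elim: b v eigb {basb} => [|x b IHb] v eigb.
  rewrite span_nil memv0 => /eqP ->.
  by exists 0%N, (fun=> 0), (fun=> 0); split=> [[]|[]|] //; rewrite big_ord0.
rewrite span_cons => /memv_addP[y /vlineP[c ->] [z Wz ->]].
have [w bw|n [u [a [inj_a eu ->]]]] := IHb z _ Wz.
  by apply: eigb; rewrite inE bw orbT.
have [mu ex] := eigb x (mem_head _ _).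
have ecx : eigenvect f mu (c *: x) by rewrite /eigenvect linearZ /= ex !scalerA
  mulrC.
(* The term [c *: x] is merged with the summand of eigenvalue [mu] if there is one and becomes a new
   summand otherwise, so the eigenvalues stay distinct. *)
have [/existsP[i /eqP ai]|/existsPn noi] := boolP [exists i, a i == mu].
  exists n, (fun j => if j == i then c *: x + u i else u j), a; split=> // [j|].
    by case: eqP => [->|_] //; rewrite /eigenvect linearD /= ecx eu ai scalerDr.
  rewrite (bigD1 i) //= [RHS](bigD1 i) //= eqxx addrA; congr (_ + _).
  by apply: eq_bigr => j /negPf ->.
exists n.+1, (oapp u (c *: x) \o unlift ord0), (oapp a mu \o unlift ord0).
split=> [j k|j|] /=.
- case: (unliftP ord0 j) (unliftP ord0 k) => [j' ->|->] [k' ->|->];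
    rewrite ?liftK ?unlift_none //=; first by move/inj_a->.
    by move/eqP; rewrite (negPf (noi j')).
  by move=> mk; have /eqP := noi k'; rewrite -mk.
- by case: (unliftP ord0 j) => [j' _|_] /=.
rewrite big_ord_recl /= unlift_none /=; congr (_ + _); apply: eq_bigr => i _.
by rewrite liftK.
Qed.

(** The eigencomponents of a vector of [U] outside [W] all lie in [U], and they cannot all lie in
    [W]. This produces the homogeneous generators. *)
Lemma eigenvect_in_diff f U W : has_eigenbasis f ->
  (forall x, x \in U -> f x \in U) -> (forall x, x \in W -> f x \in W) ->
  ~~ (U <= W)%VS ->
  exists v a, [/\ v \in U, v \notin W & eigenvect f a v].
Proof.
move=> df sU sW /subvPn[v Uv W'v].
have [n [u [a [inj_a eu defv]]]] := eigen_decomp v df.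
have Uu : forall i, u i \in U by apply: stable_eigen_sum eu inj_a _ => //;
  rewrite -defv.
have [/existsP[i W'u]|/existsPn Wu] := boolP [exists i, u i \notin W].
  by exists (u i), (a i).
case/negP: W'v; rewrite defv; apply: memv_suml => i _.
by have := Wu i; rewrite negbK.
Qed.

End LinearAlgebra.

(** * Lower central series *)

Section LieBasics.
Variables (K : fieldType) (L : lieAlgType K).
Implicit Types (x y z : L) (U V W : {vspace L}) (D f : 'End(L)).

Lemma lieDl x y z : [lie x + y, z] = [lie x, z] + [lie y, z].
Proof. by have := lie_linearl z 1 x y; rewrite !scale1r. Qed.

Lemma lieDr x y z : [lie z, x + y] = [lie z, x] + [lie z, y].
Proof. exact: raddfD. Qed.

Lemma lieNr x z : [lie z, - x] = - [lie z, x].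
Proof. exact: raddfN. Qed.

Lemma lie0r z : [lie z, 0] = 0.
Proof. exact: raddf0. Qed.

Lemma lieZr a x z : [lie z, a *: x] = a *: [lie z, x].
Proof. exact: linearZ. Qed.

Lemma lieBr x y z : [lie z, x - y] = [lie z, x] - [lie z, y].
Proof. exact: raddfB. Qed.

Lemma lieC x y : [lie x, y] = - [lie y, x].
Proof.
have := liexx (x + y); rewrite lieDl !lieDr !liexx add0r addr0.
by move/eqP; rewrite addr_eq0 => /eqP.
Qed.

Lemma lieZl a x z : [lie a *: x, z] = a *: [lie x, z].
Proof. by rewrite lieC lieZr -scalerN -lieC. Qed.

Lemma lieNl x z : [lie - x, z] = - [lie x, z].
Proof. by rewrite -scaleN1r lieZl scaleN1r. Qed.

Lemma lieBl x y z : [lie x - y, z] = [lie x, z] - [lie y, z].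
Proof. by rewrite lieDl lieNl. Qed.

Lemma lie0l z : [lie 0, z] = 0.
Proof. by rewrite -(scale0r (0 : L)) lieZl !scale0r. Qed.

Lemma lie_leibniz x y z :
  [lie x, [lie y, z]] = [lie [lie x, y], z] + [lie y, [lie x, z]].
Proof.
apply/eqP; rewrite -subr_eq0 -(lie_jacobi x y z) opprD addrA addrAC.
by rewrite -[- [lie y, _]]lieNr -lieC -[- [lie [lie x, y], z]]lieC.
Qed.

Lemma lie_sumr (I : Type) (r : seq I) (P : pred I) (F : I -> L) x :
  [lie x, \sum_(i <- r | P i) F i] = \sum_(i <- r | P i) [lie x, F i].
Proof. exact: raddf_sum. Qed.

Lemma lie_suml (I : Type) (r : seq I) (P : pred I) (F : I -> L) x :
  [lie \sum_(i <- r | P i) F i, x] = \sum_(i <- r | P i) [lie F i, x].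
Proof. by rewrite lieC lie_sumr -sumrN; apply: eq_bigr => i _;
  rewrite -lieC. Qed.

Lemma mem_lie_prodv U V x y : x \in U -> y \in V -> [lie x, y] \in lie_prodv U
  V.
Proof.
move=> Ux Vy; rewrite (coord_vbasis Ux) (coord_vbasis Vy) lie_suml.
apply: memv_suml => i _; rewrite lieZl memvZ // lie_sumr.
apply: memv_suml => j _; rewrite lieZr memvZ // memv_span //.
by apply: allpairs_f; rewrite mem_nth ?size_tuple.
Qed.

Lemma lie_prodv_sub U V W :
  (forall x y, x \in U -> y \in V -> [lie x, y] \in W) ->
  (lie_prodv U V <= W)%VS.
Proof.
move=> sub; apply/span_subvP => z /allpairsP[[x y] /= [Ux Vy ->]].
by apply: sub; apply: vbasis_mem.
Qed.

Local Notation G := (lower_central L).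

Lemma lcS m : G m.+1 = lie_prodv fullv (G m). Proof. by []. Qed.

Lemma lie_lcS m x y : y \in G m -> [lie x, y] \in G m.+1.
Proof. by move=> Gy; rewrite lcS mem_lie_prodv // memvf. Qed.

Lemma lie_lcSl m x y : x \in G m -> [lie x, y] \in G m.+1.
Proof. by move=> Gx; rewrite lieC memvN lie_lcS. Qed.

Lemma lc_subS m : (G m.+1 <= G m)%VS.
Proof.
elim: m => [|m IHm]; first exact: subvf.
by rewrite lcS; apply: lie_prodv_sub => x y _ /(subvP IHm)/lie_lcS->.
Qed.

Lemma lc_sub m p : (m <= p)%N -> (G p <= G m)%VS.
Proof.
move/subnK <-; elim: (p - m)%N => [|i IHi]; first exact: subvv.
by rewrite addSn; apply: subv_trans (lc_subS _) IHi.
Qed.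

(** As the numbering starts at [G 0 = L], this is the usual inclusion of [C^p, C^q] in C^(p+q) with
    p = i + 1 and q = j + 1. *)
Lemma lie_lc i j x y : x \in G i -> y \in G j -> [lie x, y] \in G (i + j).+1.
Proof.
elim: i => [|i IHi] in j x y *; first by move=> _; apply: lie_lcS.
(* The condition on [x] is linear, being a preimage under [ad y], so it is checked on the generators
   [[lie u, v]] of [G i.+1], where Jacobi and induction apply. *)
move=> Gx Gy; suff: (G i.+1 <= ad y @^-1: G (i.+1 + j).+1)%VS.
  by move/subvP/(_ x Gx); rewrite -memv_preim adE lieC memvN.
rewrite lcS; apply: lie_prodv_sub => u v _ Gv; rewrite -memv_preim adE.
rewrite lie_leibniz memvD //.
  by rewrite lieC memvN addSnnS IHi // lieC memvN lie_lcS.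
by apply: lie_lcS; rewrite lieC memvN IHi.
Qed.

Lemma derivation_lc D m x : is_derivation D -> x \in G m -> D x \in G m.
Proof.
move=> derD; elim: m x => [|m IHm] x; first by rewrite !memvf.
move=> Gx; suff /subvP/(_ x Gx): (G m.+1 <= D @^-1: G m.+1)%VS by rewrite
  -memv_preim.
rewrite lcS; apply: lie_prodv_sub => u v _ Gv; rewrite -memv_preim derD.
by rewrite memvD // lie_lcS // IHm.
Qed.

Lemma lc_stationary m : lie_nilpotent L -> G m.+1 = G m -> G m = 0%VS.
Proof.
case=> p Gp0 eqG; apply/eqP; rewrite -subv0 -Gp0.
have eqGi i : G (m + i) = G m.
  elim: i => [|i IHi]; first by rewrite addn0.
  by rewrite addnS lcS IHi -lcS.
by rewrite -(eqGi p) lc_sub // leq_addl.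
Qed.

Lemma eigenvect_lie D a b x y : is_derivation D -> eigenvect D a x ->
  eigenvect D b y -> eigenvect D (a + b) [lie x, y].
Proof.
by move=> derD ex ey; rewrite /eigenvect derD ex ey lieZl lieZr scalerDl.
Qed.

End LieBasics.

(** * Dimensions of the lower central series of a filiform algebra *)

Section FiliformFlag.
Variables (K : fieldType) (L : lieAlgType K).
Local Notation G := (lower_central L).
Local Notation n := (\dim {:L}).

Lemma dim_lcS m : lie_nilpotent L -> (\dim (G m.+1) <= (\dim (G m)).-1)%N.
Proof.
move=> nilL; have := dimv_leqif_eq (lc_subS L m) => /leqifP.
case: eqP => [eqG _|_ ltG]; last by case: (\dim (G m)) ltG.
by rewrite eqG (lc_stationary nilL eqG) dimv0.
Qed.

(** If [G 1] were a hyperplane, then L = <Y> + G 1; since [Y, Y] = 0, every bracket would lie in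
    [G 2], and the series would be stationary at a nonzero term. *)
Lemma dim_lc1 Y : lie_nilpotent L -> (2 <= n)%N -> Y \notin G 1 ->
  (\dim (G 1) <= n - 2)%N.
Proof.
move=> nilL n2 G'Y; rewrite leqNgt; apply/negP => lt_dG.
have dec u : exists c, u - c *: Y \in G 1.
  by apply: (@mem_codim1 _ _ fullv (G 1)); rewrite ?memvf ?subvf //; lia.
have eqG : G 2 = G 1.
  apply/eqP; rewrite eqEsubv lc_subS andTb; rewrite {1}lcS;
    apply: lie_prodv_sub => x y _ _.
  have [[a Ga] [b Gb]] := (dec x, dec y).
  rewrite -(subrK (a *: Y) x) -(subrK (b *: Y) y).
  move: (x - a *: Y) (y - b *: Y) Ga Gb => u v Gu Gv.
  rewrite lieDr lieZr !lieDl !lieZl liexx scaler0 addr0.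
  apply: memvD; last by apply/memvZ/lie_lcSl.
  by apply: memvD; [apply: lie_lcS | apply/memvZ/lie_lcS].
by move: lt_dG; rewrite (lc_stationary nilL eqG) dimv0.
Qed.

(** The Jordan block of size n - 1 is a chain of independent vectors whose i-th iterate lies in
    [G i], which bounds the dimensions from below; [dim_lc1] and strict decrease bound them from
    above. Hence for m > 0 the tails of the chain span the [G m], and [ad Y] shifts these tails. *)
Lemma filiform_flag : filiform L ->
  (2 <= n)%N /\ (forall m, (0 < m)%N -> \dim (G m) = (n - 1 - m)%N) /\
  exists Y, forall m, (0 < m)%N -> (G m.+1 <= ad Y @: G m)%VS.
Proof.
case=> nilL [[Y G'Y [_ s0 [[|x1 [|x2 [|? ?]]] [//= _ basx iter0]]]] _].
have n2 : (2 <= n)%N.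
  by move: s0; rewrite !inE negb_or => /andP[/eqP n1 _]; lia.
split=> //.
set f := ad Y in basx iter0.
have eG i m : (m <= i)%N -> iter i f x1 \in G m.
  move=> le_mi; apply: (subvP (lc_sub _ le_mi)).
  elim: i {le_mi} => [|i IHi] /=; first exact: memvf.
  by rewrite /f adE lie_lcS.
have freex : free (traject f x1 (n - 1)).
  by move/basis_free/catl_free: basx.
have free_e m : (m <= n - 1)%N -> free (traject f (iter m f x1) (n - 1 - m)).
  move=> le_m; move: freex; rewrite -{1}(subnKC le_m) trajectD.
  exact: catr_free.
have sub_e m : (<<traject f (iter m f x1) (n - 1 - m)>> <= G m)%VS.
  apply/span_subvP => _ /trajectP[i _ ->]; rewrite -iterD eG //;
    exact: leq_addl.
have dim_ge m : (m <= n - 1)%N -> (n - 1 - m <= \dim (G m))%N.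
  by move/free_e/eqP; rewrite size_traject => <-; apply: dimvS.
have dimG m : (0 < m)%N -> \dim (G m) = (n - 1 - m)%N.
  move=> m0; have dim_le : (\dim (G m) <= n - 1 - m)%N.
    elim: m m0 => // -[_ _|m IHm _]; first by have := dim_lc1 nilL n2 G'Y; lia.
    by have := dim_lcS m.+1 nilL; have := IHm isT; lia.
  have [/dim_ge|] := leqP m (n - 1); last by lia.
  by move: dim_le; lia.
split=> //; exists Y => m m0; rewrite -/f.
have [le_m|gt_m] := leqP m.+1 (n - 1); last first.
  by have /eqP := dimG m.+1 isT; rewrite (_ : (n - 1 - m.+1 = 0)%N) ?dimv_eq0;
    [move/eqP->; rewrite sub0v | lia].
have /eqP <- : (<<traject f (iter m.+1 f x1) (n - 1 - m.+1)>> == G m.+1)%VS.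
  rewrite eqEdim sub_e dimG //=.
  by have /eqP -> := free_e _ le_m; rewrite size_traject.
apply/span_subvP => _ /trajectP[i _ ->].
by rewrite -iterD addnS /= memv_img // eG // leq_addl.
Qed.

End FiliformFlag.

(** The map [p] stands for the projection onto V / W: congruences modulo [W] become equations
    between values of [p]. *)
Lemma quotient_end (K : fieldType) (V : vectType K) (W : {vspace V}) :
  exists p : 'End(V), forall x, (x \in W) = (p x == 0).
Proof.
exists (\1 - projv W)%VF => x; rewrite add_lfunE opp_lfunE id_lfunE subr_eq0.
by apply/idP/eqP => [/projv_id->|->] //; apply: memv_proj.
Qed.

Lemma lfunB (K : fieldType) (U V : vectType K) (f : 'Hom(U, V)) x y :
  f (x - y) = f x - f y.
Proof. exact: linearB. Qed.

Lemma lfunD (K : fieldType) (U V : vectType K) (f : 'Hom(U, V)) x y :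
  f (x + y) = f x + f y.
Proof. exact: linearD. Qed.

Lemma lfunZ (K : fieldType) (U V : vectType K) (f : 'Hom(U, V)) a x :
  f (a *: x) = a *: f x.
Proof. exact: linearZ. Qed.

Section LowerCentralFlag.
Variables (K : fieldType) (L : lieAlgType K).
Local Notation G := (lower_central L).
Local Notation n := (\dim {:L}).

Definition kills m (u : L) : Prop :=
  forall x, x \in G m -> [lie u, x] \in G m.+2.

Hypothesis charK : [pchar K] =i pred0.
Hypothesis n2 : (2 <= n)%N.
Hypothesis dimG : forall m, (0 < m)%N -> \dim (G m) = (n - 1 - m)%N.

Lemma lc_eq0 m : (n <= m.+1)%N -> G m = 0%VS.
Proof. by move=> le_n; apply/eqP; rewrite -dimv_eq0 dimG; lia. Qed.

Lemma lc_codim1 m v u : (0 < m)%N -> v \in G m -> v \notin G m.+1 -> u \in G m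
  ->
  exists c, u - c *: v \in G m.+1.
Proof. by move=> m0; apply: mem_codim1; rewrite ?lc_subS // !dimG; lia. Qed.

Lemma kills_at m u e : (0 < m)%N -> e \in G m -> e \notin G m.+1 ->
  [lie u, e] \in G m.+2 -> kills m u.
Proof.
move=> m0 Ge G'e Gue x Gx; have [c Gc] := lc_codim1 m0 Ge G'e Gx.
by rewrite -(subrK (c *: e) x) lieDr lieZr memvD ?memvZ // lie_lcS.
Qed.

(** If [U, Z] were in [G 2], all brackets would be, since [U] and [Z] generate modulo [G 1].
    Afterwards the current chain vector spans G_m / G_(m+1), so killing it would mean that [U] kills
    [m]. The bound [N] is n in type A and n - 1 in type B, where [U] kills the last step. *)
Lemma lc_chain U Z N :
  (N <= n)%N -> (forall u, exists a b, u - a *: U - b *: Z \in G 1) ->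
  (forall m, (0 < m)%N -> (m.+2 < N)%N -> ~ kills m U) ->
  forall m, (0 < m)%N -> (m.+1 < N)%N -> iter m (ad U) Z \notin G m.+1.
Proof.
move=> leN dec nokill; elim=> // -[_ _|m IHm] lt_m.
  rewrite /= adE; apply/negP => GUZ.
  suff /dimvS : (G 1 <= G 2)%VS by rewrite !dimG; lia.
  rewrite {1}lcS; apply: lie_prodv_sub => x y _ _.
  have [[a [b Gx]] [c [d Gy]]] := (dec x, dec y).
  move: Gx Gy; set u := x - _ - _; set v := y - _ - _ => Gx Gy.
  have -> : x = u + (b *: Z + a *: U) by rewrite /u addrA !subrK.
  have -> : y = v + (d *: Z + c *: U) by rewrite /v addrA !subrK.
  move: u v Gx Gy => u v Gu Gv.
  rewrite lieDr; apply: memvD; first exact: lie_lcS.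
  rewrite lieDl; apply: memvD; first exact: lie_lcSl.
  rewrite lieDr !lieDl !(lieZl, lieZr) !liexx !scaler0 add0r addr0.
  rewrite [[lie Z, U]]lieC; apply: memvD; first by do 2!apply: memvZ.
  by do 2!apply: memvZ; rewrite memvN.
move=> lt_m2; apply/negP => GUe; case: (nokill m.+1) => //.
apply: kills_at (IHm isT _) _ => //; last by rewrite -adE.
- elim: m.+1 => [|i IHi] /=; [exact: memvf | by rewrite adE lie_lcS].
- exact: ltnW.
Qed.

Lemma surj_nokill Y m : (0 < m)%N -> (m.+2 < n)%N ->
  (G m.+1 <= ad Y @: G m)%VS -> ~ kills m Y.
Proof.
move=> m0 lt_m sG killY; suff /dimvS : (G m.+1 <= G m.+2)%VS by rewrite !dimG;
  lia.
by apply: subv_trans sG _; apply/subvP => _ /memv_imgP[x Gx ->];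
  rewrite adE killY.
Qed.

(** * Vergne's argument: killing step 1 implies killing all steps up to n - 4 *)

Section Vergne.
Variables Y Z : L.
Hypothesis decYZ : forall u, exists a b, u - a *: Y - b *: Z \in G 1.
Hypothesis nokillY : forall m, (0 < m)%N -> (m.+2 < n)%N -> ~ kills m Y.
Hypothesis killZ1 : kills 1 Z.

Let e i := iter i (ad Y) Z.

Let eG i : e i \in G i.
Proof. by elim: i => [|i IHi] /=;
  [exact: memvf | rewrite /e /= adE lie_lcS]. Qed.

Let e'G i : (0 < i)%N -> (i.+1 < n)%N -> e i \notin G i.+1.
Proof. exact: lc_chain decYZ nokillY i. Qed.

Let eS i j : [lie e i.+1, e j] = [lie Y, [lie e i, e j]] - [lie e i, e j.+1].
Proof. by rewrite /e /= !adE lie_leibniz addrK. Qed.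

Section Step.
Variable m : nat.
Hypotheses (m1 : (1 < m)%N) (le_m : (m + 4 <= n)%N).
Hypothesis killZ : forall r, (0 < r < m)%N -> kills r Z.

(** The recursion [eS] lowers the first index down to 0, where the hypothesis on [Z] applies. *)
Let lie_e_lt i j : (i + j < m)%N -> [lie e i, e j] \in G (i + j).+2.
Proof.
elim: i j => [|i IHi] j lt_ij.
  case: j lt_ij => [|j] lt_j; first by rewrite liexx mem0v.
  by rewrite killZ ?eG //.
rewrite eS memvB //.
  by rewrite addSn; apply/lie_lcS/IHi/ltnW.
by rewrite addSnnS IHi // -addSnnS.
Qed.

(** By [lie_e_lt] the term bracketed with [Y] in [eS] vanishes modulo [G m.+2], so moving one unit
    between the indices only changes the sign. *)
Let lie_e_eq (p : 'End(L)) : (forall x, (x \in G m.+2) = (p x == 0)) ->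
  forall i j, (i + j)%N = m -> p [lie e i, e j] = (-1) ^+ i *: p [lie e 0, e m].
Proof.
move=> pG; elim=> [|i IHi] j eq_m; first by rewrite -eq_m expr0 scale1r.
have lt_m : (i + j < m)%N by rewrite -eq_m addSn.
rewrite eS linearB /= (IHi j.+1) ?addnS -?addSn // exprS mulN1r scaleNr.
have /eqP -> : p [lie Y, [lie e i, e j]] == 0.
  by rewrite -pG -eq_m addSn; apply/lie_lcS/lie_e_lt.
by rewrite sub0r.
Qed.

(* The coefficients of [e i, e j], [i + j = m], are [(-1)^i beta], which vanish
   for m even; for m odd the next layer is [(-1)^i (c0 - i beta)], antisymmetry
   gives [c0 = (m + 1)/2 beta], and Jacobi on [e 0, e 1, e (m-1)] gives
   [beta c0 = 0]. *)
Lemma vergne_step : kills m Z.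
Proof.
have lt_m1 : (m.+2 < n)%N by lia.
have lt_m2 : (m.+3 < n)%N by lia.
have lieZG i : [lie e 0, e i] \in G i.+1 by apply: lie_lcS.
have [beta Gb] := lc_codim1 (ltn0Sn _) (eG _) (e'G (ltn0Sn _) lt_m1) (lieZG m).
have [c0 Gc] := lc_codim1 (ltn0Sn _) (eG _) (e'G (ltn0Sn _) lt_m2) (lieZG m.+1).
apply: (@kills_at m Z (e m)); rewrite ?eG ?e'G //; try lia.
have [p pG] := quotient_end (G m.+2); have [q qG] := quotient_end (G m.+3).
(* The bound m + 4 <= n makes [e m.+2] nonzero modulo [G m.+3], so coefficients can be read off
   there. *)
have qe : q (e m.+2) != 0 by rewrite -qG e'G //; lia.
have pe0 : p [lie e 0, e m] = beta *: p (e m.+1).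
  by apply/eqP; rewrite -linearZ -subr_eq0 -linearB -pG.
have qe0 : q [lie e 0, e m.+1] = c0 *: q (e m.+2).
  by apply/eqP; rewrite -linearZ -subr_eq0 -linearB -qG.
have Hp i j : (i + j)%N = m -> p [lie e i, e j] = (-1) ^+ i *: p [lie e 0, e m].
  exact: lie_e_eq.
have [odd_m|even_m] := boolP (odd m); last first.
  have /eqP := Hp m./2 m./2 (etrans (addnn _) (even_halfK even_m)).
  rewrite liexx linear0 eq_sym scaler_eq0 signr_eq0 /=.
  by rewrite -pG.
have HY i j : (i + j)%N = m ->
    q [lie Y, [lie e i, e j]] = ((-1) ^+ i * beta) *: q (e m.+2).
  move=> eq_m; apply/eqP; rewrite -linearZ -subr_eq0 -linearB -qG.
  have -> : e m.+2 = [lie Y, e m.+1] by rewrite /e /= adE.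
  rewrite -lieZr -lieBr lie_lcS // pG linearB linearZ /= Hp // pe0 scalerA.
  by rewrite subrr.
have Hq i j : (i + j)%N = m.+1 ->
    q [lie e i, e j] = ((-1) ^+ i * (c0 - i%:R * beta)) *: q (e m.+2).
  elim: i j => [|i IHi] j eq_m; first by rewrite -eq_m in qe0 *;
    rewrite qe0 mul0r subr0 mul1r.
  case: eq_m => eq_m; rewrite eS lfunB HY // IHi ?addnS ?eq_m // -scalerBl.
  by congr (_ *: _); rewrite exprS -natr1; ring.
have m2 : (m = 2 * m./2 + 1)%N by rewrite -[LHS]odd_double_half odd_m -mul2n
  addnC.
set r := m./2 in m2.
(* Since m + 1 = 2 (r + 1), the pair i = j = r + 1 falls under [Hq], and its bracket is zero. *)
have c0E : c0 = r.+1%:R * beta.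
  have /eqP := Hq r.+1 r.+1 (ltac:(lia)).
  rewrite liexx linear0 eq_sym scaler_eq0 (negPf qe) orbF mulf_eq0 signr_eq0 /=.
  by rewrite subr_eq0 => /eqP.
(* Both Leibniz terms lie in [G m.+3], because [Z] kills the steps 1 and m - 1. *)
have q0 : q [lie e 0, [lie e 1, e m.-1]] = 0.
  apply/eqP; rewrite -qG lie_leibniz memvD //.
    have /lie_lc/(_ (eG m.-1)) := killZ (r := 1) (ltac:(lia)) (eG 1).
    by rewrite (_ : (3 + m.-1).+1 = m.+3) //; lia.
  have /(lie_lc (eG 1)) : [lie e 0, e m.-1] \in G m.-1.+2 by apply: killZ;
    rewrite ?eG //; lia.
  by rewrite (_ : (1 + m.-1.+2).+1 = m.+3) //; lia.
have p1 : [lie e 1, e m.-1] + beta *: e m.+1 \in G m.+2.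
  rewrite pG lfunD lfunZ Hp ?pe0; last by lia.
  by rewrite expr1 scaleN1r addNr.
have : q [lie e 0, [lie e 1, e m.-1] + beta *: e m.+1] = 0.
  by apply/eqP; rewrite -qG lie_lcS.
rewrite lieDr lieZr lfunD q0 add0r lfunZ qe0 c0E => /eqP.
rewrite !scaler_eq0 (negPf qe) orbF !mulf_eq0.
rewrite ((pcharf0P K).1 charK) /= orbb => /eqP b0.
by rewrite b0 scale0r subr0 in Gb.
Qed.

End Step.

Lemma vergne m : (0 < m)%N -> (m + 4 <= n)%N -> kills m Z.
Proof.
elim/ltn_ind: m => m IHm m0 le_m.
have [-> //|m_neq1] := eqVneq m 1%N.
have lt_m : (1 < m)%N by lia.
apply: (vergne_step lt_m le_m) => r /andP[r0 lt_r]; apply: IHm => //; lia.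
Qed.

End Vergne.

End LowerCentralFlag.

(** * Homogeneous generators *)

Section AdaptedPair.
Variables (K : fieldType) (L : lieAlgType K).
Local Notation G := (lower_central L).
Local Notation n := (\dim {:L}).

Lemma killsB m (u v : L) c : kills m u -> kills m v -> kills m (u - c *: v).
Proof.
by move=> ku kv x Gx; rewrite lieBl lieZl memvB ?memvZ // ?ku ?kv.
Qed.

Lemma kills_lc m (u : L) : u \in G 1 -> kills m u.
Proof. by move=> Gu x Gx; have := lie_lc Gu Gx. Qed.

Lemma kills_derivation (D : 'End(L)) m u : is_derivation D -> kills m u -> kills
  m (D u).
Proof.
move=> derD ku x Gx; rewrite (_ : [lie D u, x] = D [lie u, x] - [lie u, D x]).
  by rewrite memvB ?(derivation_lc derD) // ku // derivation_lc.
by rewrite derD addrK.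
Qed.

(* The two types differ in the last step [m = n - 3], where [U] acts trivially
   in type B. *)
Definition typeA (U Z : L) : Prop :=
  (forall m, (0 < m)%N -> kills m Z) /\
  (forall m, (0 < m)%N -> (m.+2 < n)%N -> ~ kills m U).

Definition typeB (U Z : L) : Prop :=
  [/\ (5 <= n)%N, forall m, (0 < m)%N -> (m + 4 <= n)%N -> kills m Z,
      forall m, (0 < m)%N -> (m + 4 <= n)%N -> ~ kills m U,
      kills (n - 3) U & ~ kills (n - 3) Z].

Definition generates_mod_lc (U Z : L) : Prop :=
  forall u, exists a b, u - a *: U - b *: Z \in G 1.

Hypothesis charK : [pchar K] =i pred0.
Hypothesis n2 : (2 <= n)%N.
Hypothesis dimG : forall m, (0 < m)%N -> \dim (G m) = (n - 1 - m)%N.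
Variable Y : L.
Hypothesis nokillY : forall m, (0 < m)%N -> (m.+2 < n)%N -> ~ kills m Y.

(** Killing is tested on one vector [e] spanning G_m modulo G_(m+1), so [D] is a preimage under
    [ad e]. It is proper as it misses [Y], and it has codimension one because [Y, e] spans the
    target line. *)
Lemma killer m : (0 < m)%N -> (m.+2 < n)%N ->
  exists D : {vspace L}, [/\ forall u, u \in D <-> kills m u,
    (G 1 <= D)%VS & \dim D = n.-1].
Proof.
move=> m0 lt_m.
have /subvPn[e Ge G'e] : ~~ (G m <= G m.+1)%VS.
  by apply/negP => /dimvS; rewrite !dimG; lia.
pose D := (ad e @^-1: G m.+2)%VS; have memD u : u \in D <-> kills m u.
  rewrite /D -memv_preim adE lieC memvN; split; last exact.
  exact: kills_at.
have D'Y : Y \notin D by apply/negP => /memD; apply: nokillY.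
exists D; split=> //; first by apply/subvP => u /kills_lc => ku; apply/memD.
have lt_D : (\dim D < n)%N.
  rewrite ltn_neqAle dimvS ?subvf // andbT (dimv_leqif_eq (subvf D)).
  by apply: contraNneq D'Y => ->; rewrite memvf.
suff : (n <= (\dim D).+1)%N by lia.
apply: (dim_codim1 (memvf Y)) => u _.
have GYe : [lie Y, e] \notin G m.+2.
  apply/negP => GYe; case: (nokillY m0 lt_m); exact: kills_at GYe.
have [c Gc] := @lc_codim1 _ _ n2 dimG m.+1 _ _ isT (lie_lcS Y Ge) GYe (lie_lcS u
  Ge).
by exists c; rewrite /D -memv_preim adE lieC memvN lieBl lieZl.
Qed.

Lemma generates_of_flag (D : {vspace L}) U Z : (G 1 <= D)%VS -> \dim D = n.-1 ->
  U \notin D -> Z \in D -> Z \notin G 1 -> generates_mod_lc U Z.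
Proof.
move=> sGD dimD D'U DZ G'Z u.
have [|a Da] := @mem_codim1 _ _ fullv D U u (subvf _) _ (memvf _) D'U (memvf _);
  first by rewrite dimD; lia.
by have [|b Gb] := mem_codim1 sGD _ DZ G'Z Da; [rewrite dimD dimG;
  lia | exists a, b].
Qed.

Variable h : 'End(L).
Hypothesis derh : is_derivation h.
Hypothesis diagh : has_eigenbasis h.

(** For n <= 3 the killing conditions are vacuous, since [G 2] is zero; any h-stable flag with
    homogeneous generators will do. *)
Lemma adapted_pair_small : (n <= 3)%N -> exists U Z a b,
  [/\ eigenvect h a U, eigenvect h b Z, generates_mod_lc U Z & typeA U Z].
Proof.
move=> n3.
have sG x : x \in G 1 -> h x \in G 1 by apply: derivation_lc.
have [||Z [b [_ G'Z eZ]]] := @eigenvect_in_diff _ _ h fullv (G 1) diagh _ sG.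
- by move=> x _; apply: memvf.
- by apply/negP => /dimvS; rewrite dimG //; lia.
pose D := (<[Z]> + G 1)%VS.
have sD x : x \in D -> h x \in D.
  case/memv_addP => _ /vlineP[c ->] [y Gy ->]; rewrite lfunD lfunZ eZ.
  by rewrite memv_add ?sG // !memvZ // memv_line.
have dimD : \dim D = n.-1.
  have : (\dim (G 1) < \dim D)%N.
    rewrite ltn_neqAle (dimv_leqif_eq (addvSr _ _)) dimvS ?addvSr // andbT.
    apply: contraNneq G'Z => ->; exact: (subvP (addvSl _ _)) (memv_line _).
  have := dimv_add_leqif <[Z]>%VS (G 1) => /leqifP; rewrite dim_vline dimG //.
  by case: ifP => _; case: (Z != 0); rewrite -/D; lia.
have [||U [a [_ D'U eU]]] := @eigenvect_in_diff _ _ h fullv D diagh _ sD.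
- by move=> x _; apply: memvf.
- by apply/negP => /dimvS; rewrite dimD; lia.
exists U, Z, a, b; split=> //.
  apply: (generates_of_flag (addvSr _ _) dimD D'U _ G'Z).
  exact: (subvP (addvSl _ _)) (memv_line _).
split=> [m m0 x Gx|m]; last by lia.
by have := lie_lcS Z Gx; rewrite (@lc_eq0 _ _ n2 dimG m.+1) ?memv0 => [/eqP->|];
  rewrite ?mem0v //; lia.
Qed.

(** [D1] is the hyperplane killing step 1, hence by Vergne all steps up to n - 4, and [D] the one
    killing step n - 3. Type A is the case where they coincide, type B the case where they
    differ. *)
Lemma adapted_pair : exists U Z a b,
  [/\ eigenvect h a U, eigenvect h b Z, generates_mod_lc U Z &
      typeA U Z \/ typeB U Z].
Proof.
have [n3|n4] := leqP n 3.
  by have [U [Z [a [b [*]]]]] := adapted_pair_small n3; exists U, Z, a, b;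
    split=> //; left.
have [//|D1 [memD1 sGD1 dimD1]] := @killer 1 isT.
have [|//|D [memD sGD dimD]] := @killer (n - 3); try lia.
have s1 x : x \in D1 -> h x \in D1 by move/memD1 => k;
  apply/memD1/kills_derivation.
have sD x : x \in D -> h x \in D by move/memD => k; apply/memD/kills_derivation.
have sG x : x \in G 1 -> h x \in G 1 by apply: derivation_lc.
have stf x : x \in fullv -> h x \in fullv by move=> _; apply: memvf.
have D1'Y : Y \notin D1 by apply/negP => /memD1; apply: nokillY.
have D1V Z : Z \in D1 -> Z \notin G 1 -> forall m, (0 < m)%N -> (m + 4 <= n)%N
  -> kills m Z.
  move=> D1Z G'Z; apply: (@vergne _ _ charK n2 dimG Y) => //; last exact/memD1.
  exact: generates_of_flag D1'Y D1Z G'Z.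
(* Modulo [D1], [Y] is a multiple of [U]; if [D1] and [U] killed step m, so would [Y]. *)
have D1'k U : U \notin D1 -> forall m, (0 < m)%N -> (m.+2 < n)%N ->
    (forall z, z \in D1 -> kills m z) -> ~ kills m U.
  move=> D1'U m m0 lt_m kD kU; case: (nokillY m0 lt_m).
  have [|c D1c] :=
    @mem_codim1 _ _ fullv D1 U Y (subvf _) _ (memvf _) D1'U (memvf _).
    by rewrite dimD1; lia.
  have -> : Y = (Y - c *: U) - (- c) *: U by rewrite scaleNr opprK subrK.
  exact: killsB (kD _ D1c) kU.
have kD1 m z : (0 < m)%N -> (m + 4 <= n)%N -> z \in D1 -> kills m z.
  move=> m0 le_m D1z; have [/kills_lc //|G'z] := boolP (z \in G 1).
  exact: D1V.
have [sD1D|nsD1D] := boolP (D1 <= D)%VS.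
  have [|Z [b [D1Z G'Z eZ]]] := eigenvect_in_diff diagh s1 sG.
    by apply/negP => /dimvS; rewrite dimD1 dimG //; lia.
  have [|U [a [_ D1'U eU]]] := eigenvect_in_diff diagh stf s1.
    by apply/negP => /dimvS; rewrite dimD1 //; lia.
  exists U, Z, a, b; split=> //; first exact: generates_of_flag D1'U D1Z G'Z.
  have kDm m z : (0 < m)%N -> z \in D1 -> kills m z.
    move=> m0 D1z; have [le_m|gt_m] := leqP (m + 4) n; first exact: kD1.
    have [eq_m|gt_m1] := eqVneq m (n - 3)%N; first by rewrite eq_m;
      apply/memD/(subvP sD1D).
    move=> x Gx; have := lie_lcS z Gx; rewrite (@lc_eq0 _ _ n2 dimG m.+1).
      by rewrite memv0 => /eqP ->; apply: mem0v.
    by lia.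
  left; split=> [m m0|m m0 lt_m]; first exact: kDm.
  by apply: D1'k => // z; apply: kDm.
(* Type B: [Z] is taken in [D1] outside [D], and [U] in [D] outside [D1]. *)
have [Z [b [D1Z D'Z eZ]]] := eigenvect_in_diff diagh s1 sD nsD1D.
have [|U [a [DU D1'U eU]]] := eigenvect_in_diff diagh sD s1.
  apply: contra nsD1D => sDD1.
  by rewrite -(dimv_leqif_sup sDD1) dimD dimD1.
exists U, Z, a, b; split=> //.
  apply: generates_of_flag D1'U D1Z _ => //.
  by apply: contra D'Z; apply: (subvP sGD).
right; split=> //.
(* For n = 4 the steps 1 and n - 3 are the same, so the two hyperplanes could not differ. *)
- have [//|n4'] := leqP 5 n; case/negP: nsD1D; apply/subvP => u /memD1 ku.
  by apply/memD; rewrite (_ : n - 3 = 1)%N //; lia.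
- by move=> m m0 le_m; apply: kD1.
- by move=> m m0 le_m; apply: D1'k => //; [lia | move=> z; apply: kD1].
- exact/memD.
by move/memD; apply/negP.
Qed.

End AdaptedPair.

(** * Homogeneous bases adapted to the lower central series *)

Section AdaptedBasis.
Variables (K : fieldType) (L : lieAlgType K).
Local Notation G := (lower_central L).
Local Notation n := (\dim {:L}).

(* The vector of index [i] is the [Y_(i+1)] of the families; in type B the last
   one is normalized by [[Y_2, Y_(n-1)] = - Y_n]. *)
Definition chain_basis (U Z : L) (i : nat) : L :=
  if i is j.+1 then iter j (ad U) Z else U.

Definition chain_basisB (U Z : L) (i : nat) : L :=
  if i == n.-1 then - [lie Z, chain_basis U Z n.-2] else chain_basis U Z i.

Definition chain_wt (a b : K) (i : nat) : K :=
  if i is j.+1 then b + j%:R * a else a.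

(** The last weight is that of [[lie Z, chain_basis U Z n.-2]], namely b plus b + (n - 3) a. *)
Definition chain_wtB (a b : K) (i : nat) : K :=
  if i == n.-1 then b + b + (n - 3)%:R * a else chain_wt a b i.

Lemma chain_basis_lc U Z i : chain_basis U Z i.+1 \in G i.
Proof.
by elim: i => [|i IHi]; rewrite ?memvf //= adE; apply: lie_lcS IHi.
Qed.

Lemma chain_basisS U Z i : chain_basis U Z i.+2 = [lie U, chain_basis U Z i.+1].
Proof. by rewrite /= adE. Qed.

Lemma chain_basis_eigen h a b U Z i : is_derivation h -> eigenvect h a U ->
  eigenvect h b Z -> eigenvect h (chain_wt a b i) (chain_basis U Z i).
Proof.
move=> derh eU eZ; case: i => [//|i]; elim: i => [|i IHi].
  by rewrite /= mul0r addr0.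
have := eigenvect_lie derh eU IHi; rewrite -chain_basisS /=.
by rewrite (_ : b + i.+1%:R * a = a + (b + i%:R * a)) // -natr1; ring.
Qed.

Hypothesis n2 : (2 <= n)%N.
Hypothesis dimG : forall m, (0 < m)%N -> \dim (G m) = (n - 1 - m)%N.

(** The shift between [E i.+1] and [G i] comes from the first quotient L / G_1, which is a plane and
    takes both [E 0] and [E 1]. *)
Definition adapted (E : nat -> L) : Prop :=
  [/\ forall u, exists a b, u - a *: E 0 - b *: E 1 \in G 1,
      forall i, E i.+1 \in G i &
      forall i, (0 < i)%N -> (i.+1 < n)%N -> E i.+1 \notin G i.+1].

(** Inserting <E 1> + G 1 between L and [G 1] refines the lower central series to a complete
    flag. *)
Lemma adapted_basis E : adapted E -> basis_of fullv [seq E i | i <- iota 0 n].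
Proof.
case=> decE GE G'E.
pose F i := match i with 0 => fullv | 1 => (<[E 1]> + G 1)%VS | _ => G i.-1 end.
have FS i : (i < n)%N -> (F i.+1 <= F i)%VS.
  by case: i => [|[|i]] _; [exact: subvf | exact: addvSr | exact: lc_subS].
have dF i : (i < n)%N -> (\dim (F i) <= (\dim (F i.+1)).+1)%N.
  case: i => [|[|i]] lt_i; rewrite /F; last by rewrite !dimG //=; lia.
    apply: (dim_codim1 (memvf (E 0))) => u _; have [a [b Gu]] := decE u.
    exists a; rewrite -(subrK (b *: E 1) (u - _)) addrC.
    by rewrite memv_add // memvZ // memv_line.
  apply: leq_trans (dimv_add_leqif _ _) _; rewrite dim_vline.
  by case: (_ != 0); rewrite /= ?addn0 ?add1n; lia.
have EF i : (i < n)%N -> E i \in F i.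
  case: i => [|[|i]] lt_i; first exact: memvf.
    exact: (subvP (addvSl _ _)) (memv_line _).
  exact: GE.
have dim0 : n = \dim (F 0%N) by [].
have dim1 : \dim (F 1%N) = n.-1.
  apply/eqP; rewrite eqn_leq; apply/andP; split.
    apply: leq_trans (dimv_add_leqif _ _) _; rewrite dim_vline dimG //.
    by case: (_ != 0); lia.
  by have := dF 0%N (ltnW n2); rewrite -dim0; lia.
apply: (basis_of_flag (F := F)) => //.
  by case: (n) n2 dimG => [|[|m]] //= _ dimG'; apply/eqP;
    rewrite -dimv_eq0 dimG' //; lia.
case=> [|[|i]] lt_i; last exact: G'E.
  apply/negP => F1E0;
    suff : (\dim (F 0%N) <= \dim (F 1%N))%N by rewrite -dim0 dim1; lia.
  apply/dimvS/subvP => u _; have [a [b Gu]] := decE u.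
  rewrite -(subrK (a *: E 0) u) memvD ?memvZ //
    -(subrK (b *: E 1) (u - _)) addrC.
  by rewrite memv_add // memvZ // memv_line.
apply/negP => G1E; suff : (\dim (F 1%N) <= \dim (G 1))%N by rewrite dimG //
  dim1; lia.
by rewrite dimvS // subv_add subvv andbT -memvE.
Qed.

Lemma typeA_adapted U Z : generates_mod_lc U Z -> typeA U Z ->
  adapted (chain_basis U Z).
Proof.
move=> gen [_ nokU]; split=> // [i|i i0 lt_i]; first exact: chain_basis_lc.
exact: (lc_chain n2 dimG (leqnn _) gen).
Qed.

Lemma typeB_chain U Z i : generates_mod_lc U Z -> typeB U Z ->
  (0 < i)%N -> (i.+2 < n)%N -> chain_basis U Z i.+1 \notin G i.+1.
Proof.
move=> gen [n5 _ nokU _ _] i0 lt_i.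
apply: (@lc_chain _ _ n2 dimG U Z n.-1) => //; first exact: leq_pred.
  by move=> m m0 lt_m; apply: nokU => //; lia.
by lia.
Qed.

Lemma chain_basisBE U Z i : (i < n.-1)%N -> chain_basisB U Z i = chain_basis U Z
  i.
Proof. by rewrite /chain_basisB ltn_neqAle => /andP[/negPf ->]. Qed.

Lemma chain_wtBE a b i : (i < n.-1)%N -> chain_wtB a b i = chain_wt a b i.
Proof. by rewrite /chain_wtB ltn_neqAle => /andP[/negPf ->]. Qed.

Lemma chain_basisB_eigen h a b U Z i : (3 <= n)%N -> is_derivation h ->
  eigenvect h a U ->
  eigenvect h b Z -> eigenvect h (chain_wtB a b i) (chain_basisB U Z i).
Proof.
move=> n3 derh eU eZ; rewrite /chain_wtB /chain_basisB.
case: eqP => _; last exact: chain_basis_eigen.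
have := eigenvect_lie derh eZ (chain_basis_eigen n.-2 derh eU eZ).
have -> : n.-2 = (n - 3).+1 by lia.
by rewrite /eigenvect /= linearN /= => ->; rewrite scalerN addrA.
Qed.

(** At step n - 3 the operator [ad U] contributes nothing; the last vector comes from [Z], which
    does not kill that step. *)
Lemma typeB_adapted U Z : generates_mod_lc U Z -> typeB U Z ->
  adapted (chain_basisB U Z).
Proof.
move=> gen tB; have [n5 _ _ _ nokZ] := tB.
have GE i : chain_basisB U Z i.+1 \in G i.
  rewrite /chain_basisB; case: eqP => [eq_i|_]; last exact: chain_basis_lc.
  have -> : i = (n - 3).+1 by lia.
  have -> : n.-2 = (n - 3).+1 by lia.
  by rewrite memvN lie_lcS // chain_basis_lc.
split=> // [u|i i0 lt_i].
  by have [a [b Gu]] := gen u; exists a, b; rewrite !chain_basisBE //; lia.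
have [lt_i2|ge_i2] := ltnP i.+2 n.
  by rewrite chain_basisBE; [apply: typeB_chain | lia].
have eq_i : i.+1 = n.-1 by lia.
rewrite /chain_basisB eq_i eqxx memvN; apply/negP => GZ; apply: nokZ.
have eq2 : n.-2 = (n - 3).+1 by lia.
apply: (@kills_at _ _ n2 dimG _ _ (chain_basis U Z n.-2)); rewrite ?eq2.
- by lia.
- exact: chain_basis_lc.
- by apply: typeB_chain => //; lia.
by rewrite eq2 in GZ; rewrite (_ : (n - 3).+2 = n.-1) //; lia.
Qed.

Section Leading.
Variables (h : 'End(L)) (wt : nat -> K) (E : nat -> L).
Hypothesis adapE : adapted E.
Hypothesis eigE : forall i, eigenvect h (wt i) (E i).
Hypothesis derh : is_derivation h.

(** Descend to the last [G m] containing [x]: there [x] is a multiple of one basis vector modulo the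
    next term, and comparing the actions of [h] on this line identifies the weight. *)
Lemma leading m x mu : (0 < m)%N -> x \in G m -> x != 0 -> eigenvect h mu x ->
  exists l c, [/\ (m < l < n)%N, c != 0, x - c *: E l \in G l & mu = wt l].
Proof.
have [_ GE G'E] := adapE.
move=> m0 Gx x0 ex; have [j] := ubnP (n - m)%N.
elim: j => // j IHj in m m0 Gx * => le_j.
have [le_m|lt_m] := leqP n m.+1.
  by move: Gx; rewrite (lc_eq0 n2 dimG le_m) memv0 (negPf x0).
have [GSx|G'Sx] := boolP (x \in G m.+1).
  have [|l [c [lt_l c0 Gl ->]]] := IHj m.+1 isT GSx; first by lia.
  by exists l, c; split=> //; lia.
have [c Gc] := lc_codim1 n2 dimG m0 (GE m) (G'E m m0 lt_m) Gx.
have c0 : c != 0 by apply: contraNneq G'Sx => c0;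
  rewrite c0 scale0r subr0 in Gc.
exists m.+1, c; split=> //; first by rewrite ltnSn.
(* Were the weights different, [h] minus [mu] would send [x - c *: E m.+1] to a nonzero multiple of
   [E m.+1], which would then lie in the h-stable [G m.+1]. *)
apply/eqP; rewrite -subr_eq0; apply: contraNT (G'E m m0 lt_m) => nz.
have := memvB (derivation_lc derh Gc) (memvZ mu Gc).
rewrite lfunB lfunZ ex eigE scalerBr opprB addrC addrA subrK !scalerA -scalerBl.
rewrite [c * _]mulrC -mulrBl => /(memvZ ((mu - wt m.+1) * c)^-1).
by rewrite scalerA mulVf ?scale1r // mulf_neq0.
Qed.

(** The remainder [x - c *: E l] has the same weight; if nonzero, it would have a leading index
    beyond [l], against uniqueness. *)
Lemma leading_uniq m x mu l : (0 < m)%N -> x \in G m -> x != 0 ->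
  eigenvect h mu x ->
  (forall i, (m < i < n)%N -> wt i = mu -> i = l) ->
  exists2 c, c != 0 & x = c *: E l /\ (m < l < n)%N.
Proof.
move=> m0 Gx x0 ex uniq_l; have [l' [c [lt_l c0 Gc wtl]]] :=
  leading m0 Gx x0 ex.
have eq_l : l' = l by apply: uniq_l.
rewrite {l'}eq_l in lt_l Gc wtl; exists c => //; split=> //.
apply/eqP; rewrite -subr_eq0; apply/negP => /negP nz.
have ec : eigenvect h mu (x - c *: E l).
  by rewrite /eigenvect lfunB lfunZ ex eigE -wtl scalerBr !scalerA mulrC.
have l0 : (0 < l)%N by lia.
have [l' [_ [lt_l' _ _ wtl']]] := leading l0 Gc nz ec.
by have : l' = l by [apply: uniq_l => //; lia]; lia.
Qed.

End Leading.

End AdaptedBasis.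

(** * Diagonal derivations and maximal tori *)

Section NatBasis.
Variables (K : fieldType) (V : vectType K).
Local Notation n := (\dim {:V}).
Variable E : nat -> V.
Hypothesis basE : basis_of fullv [seq E i | i <- iota 0 n].

Definition basis_tuple : n.-tuple V := [tuple of map E (iota_tuple n 0)].

Lemma nth_basis_tuple (i : 'I_n) : basis_tuple`_i = E i.
Proof. by rewrite /= (nth_map 0%N) ?size_iota // nth_iota. Qed.

Lemma basis_tupleP : basis_of fullv basis_tuple.
Proof. exact: basE. Qed.

Lemma basis_sum x : exists c : nat -> K, x = \sum_(i < n) c i *: E i.
Proof.
exists (fun i => if insub i is Some j then coord basis_tuple j x else 0).
rewrite {1}(coord_basis basis_tupleP (memvf x)); apply: eq_bigr => i _.
by rewrite valK nth_basis_tuple.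
Qed.

Lemma basis_sum0 (c : nat -> K) : \sum_(i < n) c i *: E i = 0 ->
  forall i, (i < n)%N -> c i = 0.
Proof.
move=> c0 i lt_i; have /freeP := basis_free basis_tupleP.
move=> /(_ (fun i => c i)) fr; apply: (fr _ (Ordinal lt_i)); rewrite -[RHS]c0.
by apply: eq_bigr => j _; rewrite nth_basis_tuple.
Qed.

Lemma basis_neq0 i : (i < n)%N -> E i != 0.
Proof.
by move=> lt_i; apply: (basis_not0 basE); apply: map_f; rewrite mem_iota.
Qed.

Lemma diag_end (w : nat -> K) :
  exists D : 'End(V), forall i, (i < n)%N -> eigenvect D (w i) (E i).
Proof.
have [f fE] := linear_of_free basis_tuple [seq w i *: E i | i <- iota 0 n].
exists (linfun f) => i lt_i; rewrite /eigenvect lfunE.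
have := fE (basis_free basE); rewrite !size_map => /(_ erefl).
rewrite -map_comp => /(congr1 (fun s => nth 0 s i)).
by rewrite !(nth_map 0%N) ?size_iota ?nth_iota.
Qed.

Lemma end_eq_basis (f g : 'End(V)) : (forall i, (i < n)%N -> f (E i) = g (E i))
  ->
  f = g.
Proof.
move=> fg; apply/lfunP => x; have [c ->] := basis_sum x.
by rewrite !linear_sum; apply: eq_bigr => i _; rewrite !linearZ /= fg.
Qed.

End NatBasis.

Lemma vline_dim1 (K : fieldType) (V : vectType K) (W : {vspace V}) v x :
  \dim W = 1%N -> v \in W -> v != 0 -> x \in W -> exists c, x = c *: v.
Proof.
move=> dW Wv v0; have /eqP <- : (<[v]> == W)%VS.
  by rewrite eqEdim -memvE Wv dim_vline v0 dW.
by case/vlineP => c ->; exists c.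
Qed.

Section DiagonalDerivations.
Variables (K : fieldType) (L : lieAlgType K).
Local Notation n := (\dim {:L}).
Variable E : nat -> L.
Hypothesis basE : basis_of fullv [seq E i | i <- iota 0 n].

Lemma diag_derivation (D : 'End(L)) (w : nat -> K) :
  (forall i, (i < n)%N -> eigenvect D (w i) (E i)) ->
  (forall i j, (i < j < n)%N -> eigenvect D (w i + w j) [lie E i, E j]) ->
  is_derivation D.
Proof.
move=> eD eD2 x y.
have eD2' i j : (i < n)%N -> (j < n)%N ->
    D [lie E i, E j] = [lie D (E i), E j] + [lie E i, D (E j)].
  move=> lt_i lt_j; rewrite !eD // lieZl lieZr -scalerDl.
  case: (ssrnat.ltngtP i j) => [lt_ij|lt_ji|->].
  - by rewrite eD2 // lt_ij.
  - by rewrite lieC linearN /= eD2 ?lt_ji // scalerN addrC.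
  - by rewrite liexx linear0 scaler0.
have [c ->] := basis_sum basE x; have [d ->] := basis_sum basE y.
rewrite lie_suml !(linear_sum D) !lie_suml -big_split; apply: eq_bigr => i _ /=.
rewrite !lie_sumr (linear_sum D) -big_split; apply: eq_bigr => j _ /=.
by rewrite !lfunZ !lieZl !lieZr !lfunZ eD2' // !scalerDr.
Qed.

Definition diag_on (f : 'End(L)) : Prop :=
  forall i, (i < n)%N -> exists a, eigenvect f a (E i).

Lemma diag_on_diagonalizable f : diag_on f -> diagonalizable_end f.
Proof.
move=> df; exists [seq E i | i <- iota 0 n]; first exact: basE.
move=> v Ev; case: (@mapP _ _ E (iota 0 n) v Ev) => i.
by rewrite mem_iota => /andP[_ lt_i] ->; apply: df.
Qed.

Lemma diag_onD f g : diag_on f -> diag_on g -> diag_on (f + g).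
Proof.
move=> df dg i lt_i; have [[a ea] [b eb]] := (df i lt_i, dg i lt_i).
by exists (a + b); rewrite /eigenvect add_lfunE ea eb scalerDl.
Qed.

Lemma diag_onZ c f : diag_on f -> diag_on (c *: f).
Proof.
move=> df i lt_i; have [a ea] := df i lt_i.
by exists (c * a); rewrite /eigenvect scale_lfunE ea scalerA.
Qed.

Lemma diag_on_comm f g : diag_on f -> diag_on g -> (f \o g = g \o f)%VF.
Proof.
move=> df dg; apply: (end_eq_basis basE) => i lt_i.
have [[a ea] [b eb]] := (df i lt_i, dg i lt_i).
by rewrite !comp_lfunE ea eb !linearZ /= ea eb !scalerA mulrC.
Qed.

Lemma is_derivationD (f g : 'End(L)) : is_derivation f -> is_derivation g ->
  is_derivation (f + g).
Proof.
move=> df dg x y; rewrite !add_lfunE df dg lieDl lieDr !addrA.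
by congr (_ + _); rewrite addrAC.
Qed.

Lemma is_derivationZ c (f : 'End(L)) : is_derivation f -> is_derivation (c *:
  f).
Proof. by move=> df x y; rewrite !scale_lfunE df lieZl lieZr scalerDr. Qed.

Lemma diag_on_line (t : torus L) h w f : \dim t = 1%N -> h \in torus_space t ->
  h != 0 -> (forall i, (i < n)%N -> eigenvect h (w i) (E i)) ->
  f \in torus_space t -> diag_on f.
Proof.
move=> dimt th h0 eh /(vline_dim1 dimt th h0)[c ->] i lt_i.
by exists (c * w i); rewrite /eigenvect scale_lfunE eh // scalerA.
Qed.

Variable t : torus L.
Hypothesis maxt : maximal_torus t.
Hypothesis diagt : forall f, f \in torus_space t -> diag_on f.

(** Everything being diagonal on [E], adding the line of [D] to [t] gives a torus again, and
    maximality absorbs it. *)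
Lemma mem_maximal_torus (D : 'End(L)) : is_derivation D -> diag_on D ->
  D \in torus_space t.
Proof.
move=> derD diagD; pose T := (torus_space t + <[D]>)%VS.
have Tdiag f : f \in T -> diag_on f.
  case/memv_addP => g tg [_ /vlineP[c ->] ->].
  by apply: diag_onD; [apply: diagt | apply: diag_onZ].
have Tder f : f \in T -> is_derivation f.
  case/memv_addP => g tg [_ /vlineP[c ->] ->].
  by apply: is_derivationD; [apply: torus_der tg | apply: is_derivationZ].
pose t' := Torus Tder (fun f Tf => diag_on_diagonalizable (Tdiag f Tf))
  (fun f g Tf Tg => diag_on_comm (Tdiag f Tf) (Tdiag g Tg)).
have /= <- := maxt (t' := t') (addvSl _ _).
exact: (subvP (addvSr _ _)) (memv_line _).
Qed.

(** Both derivations lie in the line [t], so [D'] is a multiple of [D], yet [D] vanishes on [E 1]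
    and [D'] does not. *)
Lemma rank1_no_diag2 (D D' : 'End(L)) : \dim t = 1%N -> (2 <= n)%N ->
  is_derivation D -> is_derivation D' -> diag_on D -> diag_on D' ->
  D (E 0) != 0 -> D (E 1) = 0 -> D' (E 1) != 0 -> False.
Proof.
move=> dimt n2 derD derD' dD dD' D0 D1 D'1.
have D_neq0 : D != 0 by apply: contraNneq D0 => ->; rewrite zero_lfunE.
have tD := mem_maximal_torus derD dD; have tD' := mem_maximal_torus derD' dD'.
have [c eqD'] := vline_dim1 dimt tD D_neq0 tD'.
by rewrite eqD' scale_lfunE D1 scaler0 eqxx in D'1.
Qed.

End DiagonalDerivations.

(** * Completeness of the semidirect product *)

Section SemidirectRestriction.
Variables (K : fieldType) (L : lieAlgType K) (t : torus L).

Definition semidirect_restrict (F : 'End(semidirect t)) (x : L) : L :=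
  (F ((x, 0) : semidirect t)).1.

Fact semidirect_restrict_linear F : linear (semidirect_restrict F).
Proof.
move=> a x y; rewrite /semidirect_restrict.
have -> : ((a *: x + y, 0) : semidirect t) =
    a *: ((x, 0) : semidirect t) + ((y, 0) : semidirect t).
  by congr pair; rewrite /= scaler0 addr0.
by rewrite linearP.
Qed.

HB.instance Definition _ F :=
  GRing.isLinear.Build K L L *:%R (semidirect_restrict F)
    (semidirect_restrict_linear F).

End SemidirectRestriction.

Section Completeness.
Variables (K : fieldType) (L : lieAlgType K).
Local Notation n := (\dim {:L}).
Variables (E : nat -> L) (t : torus L) (h : 'End(L)) (wt : nat -> K).
Hypothesis basE : basis_of fullv [seq E i | i <- iota 0 n].
Hypothesis maxt : maximal_torus t.
Hypothesis dimt : \dim t = 1%N.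
Hypothesis th : h \in torus_space t.
Hypothesis n0 : (0 < n)%N.
Hypothesis eigE : forall i, (i < n)%N -> eigenvect h (wt i) (E i).
Hypothesis wt_neq0 : forall i, (i < n)%N -> wt i != 0.
Hypothesis wt_inj : forall i j, (i < n)%N -> (j < n)%N -> wt i = wt j -> i = j.

Let h_neq0 : h != 0.
Proof.
apply/negP => /eqP h0; have := eigE n0; rewrite /eigenvect h0 zero_lfunE.
move/esym/eqP; rewrite scaler_eq0 (negPf (wt_neq0 n0)).
by rewrite (negPf (basis_neq0 basE n0)).
Qed.

Let tE f : f \in torus_space t -> exists c, f = c *: h.
Proof. exact: vline_dim1. Qed.

Let diagt f : f \in torus_space t -> diag_on E f.
Proof. exact: diag_on_line dimt th h_neq0 eigE. Qed.

Let h_surj x : exists y, h y = x.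
Proof.
have [c ->] := basis_sum basE x; exists (\sum_(i < n) (c i / wt i) *: E i).
rewrite linear_sum; apply: eq_bigr => i _; rewrite linearZ /= eigE // scalerA.
by rewrite divfK ?wt_neq0.
Qed.

Let h_inj x : h x = 0 -> x = 0.
Proof.
have [c ->] := basis_sum basE x; rewrite linear_sum => s0.
have {}s0 : \sum_(i < n) (c i * wt i) *: E i = 0.
  by rewrite -[RHS]s0; apply: eq_bigr => i _; rewrite linearZ /= eigE //
    scalerA.
rewrite big1 // => i _; have /eqP := basis_sum0 (c := fun i =>
  c i * wt i) basE s0 (ltn_ord i).
by rewrite mulf_eq0 (negPf (wt_neq0 _)) // orbF => /eqP ->; rewrite scale0r.
Qed.

(* As h is invertible, subtracting an inner derivation makes [Delta] send h into
   t; the weights being nonzero and distinct, it is then diagonal on E, hence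
   the action of an element of t. *)
Lemma semidirect_complete : complete (semidirect t).
Proof.
have pairE (x y : L) (r s : subvs_of t) :
    [lie ((x, r) : semidirect t), ((y, s) : semidirect t)] =
    (([lie x, y] + vsval r y - vsval s x, 0) : semidirect t) by [].
have pair0E (x y : L) :
    [lie ((x, 0) : semidirect t), ((y, 0) : semidirect t)] =
    (([lie x, y], 0) : semidirect t).
  by rewrite pairE /= !zero_lfunE subr0 addr0.
pose hh : subvs_of t := Subvs th.
have valhh : vsval hh = h by [].
split=> [[x c] central|Delta derDelta].
  have x0 : x = 0.
    apply: h_inj; have /(congr1 fst) := central ((0, hh) : semidirect t).
    by rewrite pairE /= lie0r linear0 addr0 sub0r => /eqP; rewrite oppr_eq0 =>
      /eqP.
  rewrite x0; congr pair; apply/val_inj/lfunP => y /=; rewrite zero_lfunE.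
  have /(congr1 fst) := central ((y, 0) : semidirect t).
  by rewrite pairE /= zero_lfunE subr0 x0 lie0l add0r.
pose eh : semidirect t := (0, hh).
have ehE y s : [lie eh, ((y, s) : semidirect t)] = (h y, 0).
  by rewrite pairE lie0l linear0 subr0 add0r.
(* The bracket of (z, 0) with [eh] is (- h z, 0), so subtracting [ad (z, 0)] cancels the L-component
   of [Delta eh] for this [z]. *)
have [z hz] := h_surj (- (Delta eh).1).
set c := (Delta eh).2.
have [D' [derD' D'eh DeltaE]] : exists D' : 'End(semidirect t),
    [/\ is_derivation D', D' eh = (0, c) &
       forall u, Delta u = D' u + [lie ((z, 0) : semidirect t), u]].
  exists (Delta - ad ((z, 0) : semidirect t)); split=> [||u].
  - apply: is_derivationD => // u v; rewrite !opp_lfunE !adE lieNl lieNr -opprD.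
    by rewrite lie_leibniz.
  - rewrite add_lfunE opp_lfunE adE pairE {}/c; case: (Delta eh) hz =>
    u s /= hz.
    congr pair => /=; last by rewrite oppr0 addr0.
    by rewrite lie0r zero_lfunE hz !add0r opprK subrr.
  by rewrite add_lfunE opp_lfunE adE subrK.
have [gam cE] := tE (subvsP c).
(* Apply [D'] to [h, E i] = wt i E i. The t-component vanishes since wt i <> 0; the coefficient at j
   = i forces gam = 0, and those at j <> i vanish since the weights are distinct. *)
have D'E i : (i < n)%N -> gam = 0 /\ exists a, D' (E i, 0) = (a *: E i, 0).
  move=> lt_i; case defy: (D' (E i, 0)) => [y s].
  have := derD' eh (E i, 0).
  rewrite ehE eigE // defy D'eh ehE pairE.
  have -> : ((wt i *: E i, 0) : semidirect t) = wt i *: ((E i, 0) : semidirect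
    t).
    by congr pair; rewrite scaler0.
  rewrite linearZ /= defy => eq2.
  have /eqP := congr1 snd eq2;
    rewrite /= addr0 scaler_eq0 (negPf (wt_neq0 lt_i)) /= => /eqP s0.
  have := congr1 fst eq2;
    rewrite /= lie0l linear0 subr0 add0r cE scale_lfunE eigE // scalerA.
  have [d ->] := basis_sum basE y; rewrite (linear_sum h) scaler_sumr => eq1.
  have sum0 : \sum_(j < n) ((wt i - wt j) * d j - (gam * wt i) * (j == i :>
    nat)%:R) *: E j = 0.
    have -> : \sum_(j < n) ((wt i - wt j) * d j - (gam * wt i) * (j == i :>
      nat)%:R) *: E j =
        \sum_(j < n) (wt i *: (d j *: E j)) - (gam * wt i) *: E i - \sum_(j < n)
          h (d j *: E j).
      rewrite (_ : (gam * wt i) *: E i = \sum_(j < n) ((gam * wt i) * (j == i :>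
        nat)%:R) *: E j).
        rewrite -!sumrB; apply: eq_bigr => j _; rewrite lfunZ eigE // !scalerA.
        by rewrite -!scalerBl; congr (_ *: _); ring.
      rewrite (bigD1 (Ordinal lt_i)) //= eqxx mulr1 big1 ?addr0 // => j ne_j.
      by rewrite (_ : (j == i :> nat) = false) ?mulr0 ?scale0r //;
        apply: negPf ne_j.
    by rewrite eq1 addrAC addrK subrr.
  have coef j lt_j := basis_sum0 (c := fun j =>
    (wt i - wt j) * d j - (gam * wt i) * (j == i)%:R) basE sum0 (i := j) lt_j.
  split.
    have /eqP := coef i lt_i;
      rewrite subrr mul0r sub0r eqxx mulr1 oppr_eq0 mulf_eq0.
    by rewrite (negPf (wt_neq0 lt_i)) orbF => /eqP.
  exists (d i); rewrite s0; congr pair.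
  rewrite (bigD1 (Ordinal lt_i)) //= big1 ?addr0 // => j ne_j.
  have ne_ji : (j == i :> nat) = false by apply: negPf ne_j.
  have /eqP := coef j (ltn_ord j); rewrite ne_ji mulr0 subr0 mulf_eq0 subr_eq0.
  case/orP => [/eqP eq_wt|/eqP ->]; last by rewrite scale0r.
  by have := wt_inj lt_i (ltn_ord j) eq_wt => eq_ij;
    rewrite eq_ij eqxx in ne_ji.
have gam0 : gam = 0 by have [] := D'E _ n0.
have c0 : c = 0 by apply/val_inj; rewrite /= cE gam0 scale0r.
pose D : 'End(L) := linfun (semidirect_restrict D').
(* Every [x] is a bracket [h, y], and brackets have no t-component, so [D'] preserves L. *)
have D'x x : D' ((x, 0) : semidirect t) = ((D x, 0) : semidirect t).
  rewrite [LHS]surjective_pairing; congr pair; first by rewrite lfunE.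
  have [y <-] := h_surj x; have := derD' eh (y, 0); rewrite ehE => ->.
  by rewrite /= addr0.
have tD : D \in torus_space t.
  apply: (mem_maximal_torus basE maxt diagt) => [x y|i lt_i].
    have := derD' ((x, 0) : semidirect t) ((y, 0) : semidirect t);
      rewrite pair0E !D'x !pair0E.
    exact: (congr1 fst).
  have [_ [a Da]] := D'E i lt_i; exists a.
  by move: Da; rewrite D'x => /(congr1 fst).
have D'2 u : D' u = [lie ((0, vsproj t D) : semidirect t), u].
  case: u => x s; rewrite pairE lie0l linear0 subr0 add0r vsprojK //.
  have [b sE] := tE (subvsP s).
  have -> : ((x, s) : semidirect t) = (x, 0) + b *: eh.
    by congr pair; rewrite /= ?scaler0 ?addr0 // add0r; apply/val_inj.
  by rewrite linearD linearZ /= D'x D'eh c0; congr pair;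
    rewrite /= ?scaler0 ?addr0.
exists (z, vsproj t D); apply/lfunP => u.
rewrite DeltaE D'2 -lieDl adE; congr (lie_bracket _ _).
by congr pair; rewrite /= ?add0r ?addr0.
Qed.

End Completeness.

(** * Exclusion of the rank-two models *)

Section ModelExclusion.
Variables (K : fieldType) (L : lieAlgType K).
Local Notation G := (lower_central L).
Local Notation n := (\dim {:L}).
Local Notation E := (@chain_basis K L).

Hypothesis n2 : (2 <= n)%N.
Hypothesis dimG : forall m, (0 < m)%N -> \dim (G m) = (n - 1 - m)%N.

Lemma lc_top x m : (n <= m.+1)%N -> x \in G m -> x = 0.
Proof. by move=> le_m; rewrite (lc_eq0 n2 dimG le_m) memv0 => /eqP. Qed.

Lemma chain_basis_top U Z i : (n <= i)%N -> E U Z i = 0.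
Proof.
case: i => [|i] le_i; first by move: n2; rewrite leqn0 in le_i;
  rewrite (eqP le_i).
exact: lc_top le_i (chain_basis_lc U Z i).
Qed.

Lemma lie_chain_basis U Z i j : [lie E U Z i.+1, E U Z j.+1] \in G (i + j).+1.
Proof. by apply: lie_lc; apply: chain_basis_lc. Qed.

Lemma lie_chain_basisS U Z i j : [lie E U Z i.+2, E U Z j.+1] =
  [lie U, [lie E U Z i.+1, E U Z j.+1]] - [lie E U Z i.+1, E U Z j.+2].
Proof. by rewrite !chain_basisS lie_leibniz addrK. Qed.

Lemma chain_wtS (a b : K) i : chain_wt a b i.+2 = a + chain_wt a b i.+1.
Proof. by rewrite /= -natr1; ring. Qed.

(** Here L is the model L_n: the only brackets left are [U, E_j] = E_(j+1), which are compatible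
    with arbitrary weights of [U] and [Z]. *)
Lemma typeA_Ln_derivation U Z (al be : K) : generates_mod_lc U Z -> typeA U Z ->
  (forall i j, [lie E U Z i.+1, E U Z j.+1] = 0) ->
  exists2 D : 'End(L), is_derivation D &
    forall i, (i < n)%N -> eigenvect D (chain_wt al be i) (E U Z i).
Proof.
move=> gen tA br0; have basE :=
  adapted_basis n2 dimG (typeA_adapted n2 dimG gen tA).
have [D eD] := diag_end basE (chain_wt al be); exists D => //.
apply: (diag_derivation basE eD) => i j /andP[lt_ij lt_j].
case: j => [//|j] in lt_ij lt_j *; case: i => [|i] in lt_ij *; last first.
  by rewrite br0 /eigenvect linear0 scaler0.
rewrite -chain_basisS -chain_wtS; have [/eD //|le_n] := ltnP j.+2 n.
by rewrite chain_basis_top // /eigenvect linear0 scaler0.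
Qed.

(** Here L is the model Q_n: besides the action of [U], only pairs with i + j = n - 3 remain. They
    land on the last line, and their weight 2 be + (n - 3) al does not depend on the pair. *)
Lemma typeB_Qn_derivation U Z (al be : K) : generates_mod_lc U Z -> typeB U Z ->
  (forall i j, ((i + j).+3 < n)%N -> [lie E U Z i.+1, E U Z j.+1] = 0) ->
  exists2 D : 'End(L), is_derivation D &
    forall i, (i < n)%N -> eigenvect D (chain_wtB L al be i) (chain_basisB U Z
      i).
Proof.
move=> gen tB br0; have adB := typeB_adapted n2 dimG gen tB.
have basE := adapted_basis n2 dimG adB; have [n5 _ _ kU _] := tB.
have [D eD] := diag_end basE (chain_wtB L al be); exists D => //.
have eig0 (w : K) x : x = 0 -> eigenvect D w x.
  by move=> ->; rewrite /eigenvect linear0 scaler0.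
have [_ GB G'B] := adB.
apply: (diag_derivation basE eD) => i j /andP[lt_ij lt_j].
case: j => [//|j] in lt_ij lt_j *.
(* The last basis vector is central. *)
have [lt_j1|ge_j1] := ltnP j.+1 n.-1; last first.
  have Gj : chain_basisB U Z j.+1 \in G n.-2 by apply: (subvP (lc_sub L _) _ (GB
    j)); lia.
  by apply/eig0/(@lc_top _ n.-1); [lia | have :=
    lie_lcS (chain_basisB U Z i) Gj; rewrite (_ : n.-2.+1 = n.-1) //; lia].
rewrite !chain_basisBE ?chain_wtBE //; try lia.
case: i => [|i] in lt_ij *.
  have [lt_j2|ge_j2] := ltnP j.+2 n.-1.
    rewrite -chain_basisS -(chain_basisBE _ _ lt_j2) -chain_wtS -(chain_wtBE _ _
      lt_j2).
    by apply: eD; lia.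
  have eq_j : j = (n - 3)%N by lia.
  apply/eig0/(@lc_top _ (n - 3).+2); first by lia.
  by rewrite eq_j; apply/kU/chain_basis_lc.
have [lt_n|ge_n] := ltnP (i + j).+3 n; first exact/eig0/br0.
have [le_n|gt_n] := leqP n (i + j).+2.
  exact/eig0/(lc_top le_n)/lie_chain_basis.
have eq_ij : (i + j).+1 = n.-2 by lia.
have n2S : n.-2.+1 = n.-1 by lia.
have lt_n2 : (0 < n.-2)%N by lia.
have lt_n1 : (n.-2.+1 < n)%N by lia.
have := lie_chain_basis U Z i j; rewrite eq_ij => Gij.
have [c /lc_top eq0] := lc_codim1 n2 dimG lt_n2 (GB _) (G'B _ lt_n2 lt_n1) Gij.
have {eq0}/eqP : [lie E U Z i.+1, E U Z j.+1] - c *: chain_basisB U Z n.-2.+1 =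
  0.
  by apply: eq0; lia.
rewrite subr_eq0 => /eqP ->;
  rewrite /eigenvect lfunZ (eD _ lt_n1) !scalerA mulrC.
congr (_ * _ *: _); rewrite /chain_wtB n2S eqxx /=.
by rewrite (_ : (n - 3)%N = (i + j)%N) ?natrD; [ring | lia].
Qed.

Variables (t : torus L) (h : 'End(L)) (a b : K) (U Z : L).
Hypothesis charK : [pchar K] =i pred0.
Hypothesis maxt : maximal_torus t.
Hypothesis dimt : \dim t = 1%N.
Hypothesis th : h \in torus_space t.
Hypothesis h0 : h != 0.
Hypothesis eU : eigenvect h a U.
Hypothesis eZ : eigenvect h b Z.
Hypothesis gen : generates_mod_lc U Z.

Let derh : is_derivation h := torus_der th.

(** The derivations with weights (1, 0) and (0, 1) on (U, Z) are independent, against rank one. *)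
Lemma typeA_not_Ln : typeA U Z ->
  ~ (forall i j, [lie E U Z i.+1, E U Z j.+1] = 0).
Proof.
move=> tA br0; have basE :=
  adapted_basis n2 dimG (typeA_adapted n2 dimG gen tA).
have diagt f : f \in torus_space t -> diag_on (E U Z) f.
  by apply: (diag_on_line dimt th h0 (w := chain_wt a b)) => i _;
    apply: chain_basis_eigen.
have [D derD eD] := typeA_Ln_derivation 1 0 gen tA br0.
have [D' derD' eD'] := typeA_Ln_derivation 0 1 gen tA br0.
have n0 : (0 < n)%N by lia.
apply: (rank1_no_diag2 basE maxt diagt dimt n2 derD derD') =>
  [i lt_i|i lt_i|||].
- by exists (chain_wt 1 0 i); apply: eD.
- by exists (chain_wt 0 1 i); apply: eD'.
- by rewrite (eD 0%N n0) scale1r (basis_neq0 basE n0).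
- by rewrite (eD 1%N n2) /chain_wt mul0r addr0 scale0r.
by rewrite (eD' 1%N n2) /chain_wt mul0r addr0 scale1r (basis_neq0 basE n2).
Qed.

Lemma typeB_not_Qn : typeB U Z ->
  ~ (forall i j, ((i + j).+3 < n)%N -> [lie E U Z i.+1, E U Z j.+1] = 0).
Proof.
move=> tB br0; have basE :=
  adapted_basis n2 dimG (typeB_adapted n2 dimG gen tB).
have [n5 _ _ _ _] := tB.
have diagt f : f \in torus_space t -> diag_on (chain_basisB U Z) f.
  apply: (diag_on_line dimt th h0 (w := chain_wtB L a b)) => i _.
  by apply: chain_basisB_eigen => //; lia.
have [D derD eD] := typeB_Qn_derivation 1 0 gen tB br0.
have [D' derD' eD'] := typeB_Qn_derivation 0 1 gen tB br0.
have n0 : (0 < n)%N by lia.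
apply: (rank1_no_diag2 basE maxt diagt dimt n2 derD derD') =>
  [i lt_i|i lt_i|||].
- by exists (chain_wtB L 1 0 i); apply: eD.
- by exists (chain_wtB L 0 1 i); apply: eD'.
- rewrite (eD 0%N n0) chain_wtBE ?scale1r ?(basis_neq0 basE n0) //; lia.
- rewrite (eD 1%N n2) chain_wtBE /chain_wt ?mul0r ?addr0 ?scale0r //; lia.
rewrite (eD' 1%N n2) chain_wtBE /chain_wt ?mul0r ?addr0 ?scale1r ?(basis_neq0
  basE n2) //; lia.
Qed.

(** If a = 0, every [E i.+1] has weight b and their brackets have weight 2b. A nonzero bracket would
    force b = 0 and then h = 0, so L would be L_n. *)
Lemma typeA_wt_neq0 : typeA U Z -> a != 0.
Proof.
move=> tA; apply/negP => /eqP a0; apply: (typeA_not_Ln tA) => i j.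
have adE := typeA_adapted n2 dimG gen tA; have basE :=
  adapted_basis n2 dimG adE.
have eE l := chain_basis_eigen l derh eU eZ.
have [//|nz] := eqVneq [lie E U Z i.+1, E U Z j.+1] 0.
have eB := eigenvect_lie derh (eE i.+1) (eE j.+1).
have [l [_ [lt_l _ _]]] :=
  leading n2 dimG adE eE derh (ltn0Sn _) (lie_chain_basis U Z i j) nz eB.
case: l lt_l => [//|l] _; rewrite /= a0 !mulr0 !addr0 => bb.
have b0 : b = 0 by apply: (addrI b); rewrite bb addr0.
case/eqP: h0; apply: (end_eq_basis basE) => -[|m] _.
  by rewrite eU a0 scale0r zero_lfunE.
by rewrite eE /= a0 b0 mulr0 addr0 scale0r zero_lfunE.
Qed.

End ModelExclusion.

(** * Nonvanishing of the weight of U in type B *)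

Section TypeBWeight.
Variables (K : fieldType) (L : lieAlgType K).
Local Notation G := (lower_central L).
Local Notation n := (\dim {:L}).
Local Notation E := (@chain_basis K L).

Hypothesis n2 : (2 <= n)%N.
Hypothesis dimG : forall m, (0 < m)%N -> \dim (G m) = (n - 1 - m)%N.

Lemma generates_modify U Z y : y \in G 1 -> generates_mod_lc U Z ->
  generates_mod_lc U (Z + y).
Proof.
move=> Gy gen u; have [a [b Gu]] := gen u; exists a, b.
by rewrite scalerDr opprD addrA memvB // memvZ.
Qed.

Lemma typeB_modify U Z y : y \in G 1 -> typeB U Z -> typeB U (Z + y).
Proof.
move=> Gy [n5 kZ nkU kU nkZ]; have ky m : kills m y by apply: kills_lc.
have yE : Z + y = Z - (-1) *: y by rewrite scaleN1r opprK.
split=> // [m m0 le_m|kZy]; first by rewrite yE; apply: killsB => //; apply: kZ.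
apply: nkZ; rewrite -(addrK y Z) -[y in _ - y]scale1r.
exact: killsB.
Qed.

Variables (t : torus L) (h : 'End(L)) (a b : K) (U : L).
Hypothesis charK : [pchar K] =i pred0.
Hypothesis maxt : maximal_torus t.
Hypothesis dimt : \dim t = 1%N.
Hypothesis th : h \in torus_space t.
Hypothesis h0 : h != 0.
Hypothesis eU : eigenvect h a U.

Let derh : is_derivation h := torus_der th.

Section ZeroWeight.
Hypothesis a0 : a = 0.
Variable Z : L.
Hypothesis eZ : eigenvect h b Z.
Hypothesis gen : generates_mod_lc U Z.
Hypothesis tB : typeB U Z.

Let n5 : (5 <= n)%N. Proof. by case: tB. Qed.

Let eB l : eigenvect h (chain_wtB L a b l) (chain_basisB U Z l).
Proof. by apply: chain_basisB_eigen => //; lia. Qed.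

Let adB : adapted (chain_basisB U Z). Proof. exact: typeB_adapted. Qed.

Let b0 : b != 0.
Proof.
apply/negP => /eqP b0; have basE := adapted_basis n2 dimG adB; case/eqP: h0.
apply: (end_eq_basis basE) => i _; rewrite eB zero_lfunE /chain_wtB b0 a0.
by case: ifP => _; case: i => [|i]; rewrite /= ?mulr0 ?addr0 scale0r.
Qed.

(** With a = 0 the chain beyond [U] has weight b, and only the last basis vector has weight 2b,
    different from b as b <> 0. *)
Lemma zero_weight_lie i j : ((i + j).+3 < n)%N ->
  [lie E U Z i.+1, E U Z j.+1] \in G n.-2.
Proof.
move=> lt_ij; have [->|nz] := eqVneq [lie E U Z i.+1, E U Z j.+1] 0.
  exact: mem0v.
have eij := eigenvect_lie derh (chain_basis_eigen i.+1 derh eU eZ)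
  (chain_basis_eigen j.+1 derh eU eZ).
have [|c _ [-> _]] := leading_uniq (l :=
  n.-1) n2 dimG adB eB derh (ltn0Sn _) (lie_chain_basis U Z i j) nz eij.
  case=> [//|l] /andP[_ lt_l]; rewrite /chain_wtB; case: eqP => // _.
  by rewrite /= a0 !mulr0 !addr0 => /eqP;
    rewrite -subr_eq0 opprD addrA subrr sub0r oppr_eq0 (negPf b0).
rewrite memvZ //; have [_ /(_ n.-2)] := adB.
by rewrite (_ : n.-2.+1 = n.-1) //; lia.
Qed.

(** By [zero_weight_lie] the brackets lie in the last nonzero term, which [ad U] annihilates, so the
    recursion reduces to a change of sign. *)
Lemma zero_weight_lie_sign i j : ((i + j).+2 < n)%N ->
  [lie E U Z i.+1, E U Z j.+1] = (-1) ^+ i *: [lie Z, E U Z (i + j).+1].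
Proof.
elim: i j => [|i IHi] j lt_ij; first by rewrite scale1r.
rewrite lie_chain_basisS (IHi j.+1); last by rewrite -addSnnS.
rewrite -addSnnS exprS mulN1r scaleNr.
rewrite (@lc_top _ _ n2 dimG [lie U, _] n.-1) ?sub0r //; first by lia.
have /(lie_lcS U) := zero_weight_lie (i := i) (j := j) lt_ij.
by rewrite (_ : n.-2.+1 = n.-1) //; lia.
Qed.

(** Up to sign this is the bracket of the middle chain vector with itself. *)
Lemma zero_weight_lie_even j : ~~ odd j -> (j.+2 < n)%N -> [lie Z, E U Z j.+1] =
  0.
Proof.
move=> even_j lt_j; have jE : (j./2 + j./2 = j)%N by rewrite addnn even_halfK.
have := zero_weight_lie_sign (i := j./2) (j := j./2); rewrite jE liexx =>
  /(_ lt_j).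
by move/esym/eqP; rewrite scaler_eq0 signr_eq0 => /eqP.
Qed.

Lemma zero_weight_top : [lie Z, E U Z n.-2] != 0.
Proof.
have [_ _ G'B] := adB; have lt_n : (0 < n.-2)%N && (n.-2.+1 < n)%N by lia.
have n2S : n.-2.+1 = n.-1 by lia.
case/andP: lt_n => lt_0 /(G'B _ lt_0); rewrite n2S /chain_basisB eqxx.
by apply: contraNneq => ->; rewrite oppr0 mem0v.
Qed.

Lemma zero_weight_odd : odd (n - 3).
Proof.
apply: contraNT zero_weight_top => /zero_weight_lie_even;
  rewrite (_ : (n - 3).+1 = n.-2); last by lia.
by move=> -> //; lia.
Qed.

(* Replacing [Z] by [Z + c N^(2s) Z] with [N = ad U] kills the coefficient of
   [Z, N^j Z] for [j = n - 3 - 2s] without changing those of higher index. *)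
Lemma zero_weight_step p : (p < n - 3)%N ->
  (forall j, (n - 3 - p <= j < n - 3)%N -> [lie Z, E U Z j.+1] = 0) ->
  exists Z', [/\ eigenvect h b Z', generates_mod_lc U Z', typeB U Z' &
    forall j, (n - 3 - p.+1 <= j < n - 3)%N -> [lie Z', E U Z' j.+1] = 0].
Proof.
move=> lt_p IH; set j0 := (n - 3 - p.+1)%N.
have [even_j0|/negPn odd_j0] := boolP (~~ odd j0).
  exists Z; split=> // j /andP[le_j lt_j]; have [->|ne_j] := eqVneq j j0.
    by apply: zero_weight_lie_even => //; lia.
  by apply: IH; lia.
(* Both n - 3 and [j0] are odd, so their difference p + 1 is even. *)
pose s := p.+1./2; have eq_s : p.+1 = (s + s)%N.
  by rewrite addnn even_halfK //; have := zero_weight_odd;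
    rewrite /j0 in odd_j0; lia.
have s0 : (0 < s)%N by lia.
have [_ GB G'B] := adB.
have [c0 eqc0] : exists c0, [lie Z, E U Z j0.+1] = c0 *: [lie Z, E U Z n.-2].
  have lt_n1 : (n.-2.+1 < n)%N by lia.
  have lt_n2 : (0 < n.-2)%N by lia.
  have Gj : [lie Z, E U Z j0.+1] \in G n.-2.
    by apply: (zero_weight_lie (i := 0)); lia.
  have [c] := lc_codim1 n2 dimG lt_n2 (GB _) (G'B _ lt_n2 lt_n1) Gj.
  have n2S : n.-2.+1 = n.-1 by lia.
  move/(lc_top n2 dimG) => Gc; exists (- c).
  have /eqP : [lie Z, E U Z j0.+1] - c *: chain_basisB U Z n.-2.+1 = 0 by apply:
    Gc; lia.
  by rewrite n2S /chain_basisB eqxx scalerN scaleNr subr_eq0 => /eqP.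
(* The modification adds c [Z, .] and c [W, .], each c times the top bracket, so the new coefficient
   is c0 + 2c. *)
pose c := - c0 / 2%:R; pose W := E U Z (s + s).+1.
have GW : W \in G 1 by apply: (subvP (lc_sub _ _) _ (chain_basis_lc U Z _));
  lia.
have EW j : E U (Z + c *: W) j.+1 = E U Z j.+1 + c *: E U Z (j + (s + s)).+1.
  elim: j => [//|j IHj]; rewrite chain_basisS IHj lieDr lieZr -!chain_basisS.
  by rewrite addSn.
exists (Z + c *: W); split.
- have := chain_basis_eigen (s + s).+1 derh eU eZ; rewrite /= a0 mulr0 addr0 =>
  eW.
  by rewrite /eigenvect lfunD lfunZ eZ eW scalerDr !scalerA mulrC.
- by apply: generates_modify => //; apply: memvZ.
- by apply: typeB_modify => //; apply: memvZ.
have j0E : (j0 + (s + s) = n - 3)%N by rewrite -eq_s /j0 subnK.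
move=> j /andP[le_j lt_j]; rewrite EW lieDl !lieDr !lieZl !lieZr.
have top i k : (n <= (i + k).+2)%N -> [lie E U Z i.+1, E U Z k.+1] = 0.
  by move=> le_n; apply: (lc_top n2 dimG le_n); apply: lie_chain_basis.
rewrite (top (s + s)%N (j + (s + s))%N) ?scaler0 ?addr0; last by lia.
have [eq_j|ne_j] := eqVneq j j0; last first.
  rewrite IH ?(top 0%N (j + (s + s))%N) ?(top (s + s)%N j) ?scaler0 ?addr0 //;
    lia.
have -> : [lie W, E U Z j.+1] = [lie Z, E U Z (j + (s + s)).+1].
  rewrite zero_weight_lie_sign; last by lia.
  by rewrite -signr_odd addnn odd_double scale1r -addnn addnC.
rewrite eq_j eqc0 (_ : (j0 + (s + s)).+1 = n.-2); last by lia.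
rewrite -addrA -!scalerDl.
rewrite (_ : c0 + (c + c) = 0) ?scale0r // /c; have := (pcharf0P K).1 charK 2.
by move/negbT => two; field.
Qed.

End ZeroWeight.

(** If a = 0, successive modifications of [Z] remove all brackets below the top one, which leaves
    the excluded model Q_n. *)
Lemma typeB_wt_neq0 Z : eigenvect h b Z -> generates_mod_lc U Z -> typeB U Z ->
  a != 0.
Proof.
move=> eZ gen tB; apply/negP => /eqP a0; have [n5 _ _ _ _] := tB.
have claim p : (p <= n - 3)%N -> exists Z', [/\ eigenvect h b Z',
    generates_mod_lc U Z', typeB U Z' &
    forall j, (n - 3 - p <= j < n - 3)%N -> [lie Z', E U Z' j.+1] = 0].
  elim: p => [|p IHp] le_p; first by exists Z; split=> // j; lia.
  have [Z' [eZ' gen' tB' br0]] := IHp (ltnW le_p).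
  exact: (zero_weight_step a0 eZ' gen' tB' le_p br0).
have [Z' [eZ' gen' tB' br0]] := claim _ (leqnn _).
apply: (typeB_not_Qn n2 dimG maxt dimt th h0 eU eZ' gen' tB') => i j lt_ij.
rewrite zero_weight_lie_sign //; last exact: ltnW.
by rewrite br0 ?scaler0 //; lia.
Qed.

End TypeBWeight.

(** * Structure constants and the families *)

Section ChainStructure.
Variables (K : fieldType) (L : lieAlgType K).
Local Notation G := (lower_central L).
Local Notation n := (\dim {:L}).
Local Notation E := (@chain_basis K L).

Hypothesis charK : [pchar K] =i pred0.
Hypothesis n2 : (2 <= n)%N.
Hypothesis dimG : forall m, (0 < m)%N -> \dim (G m) = (n - 1 - m)%N.

Lemma natr_inj_char0 : injective (fun i : nat => i%:R : K).
Proof.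
have le_inj i j : (i <= j)%N -> i%:R = j%:R :> K -> i = j.
  move=> le_ij eq_ij; apply/eqP; rewrite eqn_leq le_ij /= -subn_eq0.
  by rewrite -((pcharf0P K).1 charK) natrB // eq_ij subrr.
move=> i j eq_ij; have [|/ltnW] := leqP i j; first by move/le_inj; apply.
by move/le_inj => e; apply/esym/e.
Qed.

Lemma chain_wt_inj (a b : K) i j : a != 0 ->
  chain_wt a b i.+1 = chain_wt a b j.+1 -> i = j.
Proof. by move=> a0 /addrI/(mulIf a0)/natr_inj_char0. Qed.

Lemma leading_inj h wt (Y : nat -> L) m x mu : adapted Y ->
  (forall i, eigenvect h (wt i) (Y i)) -> is_derivation h ->
  (0 < m)%N -> x \in G m -> x != 0 -> eigenvect h mu x ->
  (forall i j, (m < i < n)%N -> (m < j < n)%N -> wt i = mu -> wt j = mu -> i =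
    j) ->
  exists l c, [/\ (m < l < n)%N, c != 0, x = c *: Y l & wt l = mu].
Proof.
move=> adY eY derh m0 Gx x0 ex inj.
have [l [_ [lt_l _ _ wl]]] := leading n2 dimG adY eY derh m0 Gx x0 ex.
have [|c c0 [eqx _]] := leading_uniq (l := l) n2 dimG adY eY derh m0 Gx x0 ex.
  by move=> i lt_i wi; apply: inj.
by exists l, c.
Qed.

Variables (h : 'End(L)) (a b : K) (U Z : L).
Hypothesis derh : is_derivation h.
Hypothesis eU : eigenvect h a U.
Hypothesis eZ : eigenvect h b Z.
Hypothesis gen : generates_mod_lc U Z.
Hypothesis a0 : a != 0.

(** Taken at N = n in type A and at N = n - 1 in type B, where the brackets reaching the last basis
    vector are left out. *)
Definition chain_mult N := forall i j, ((i + j).+2 < N)%N ->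
  [lie E U Z i.+1, E U Z j.+1] != 0 ->
  exists l c, [/\ ((i + j).+1 < l < N)%N, c != 0,
    [lie E U Z i.+1, E U Z j.+1] = c *: E U Z l &
    chain_wt a b l = chain_wt a b i.+1 + chain_wt a b j.+1].

Lemma typeA_mult : typeA U Z -> chain_mult n.
Proof.
move=> tA i j _ nz; have adE := typeA_adapted n2 dimG gen tA.
have eE l := chain_basis_eigen l derh eU eZ.
apply: (leading_inj adE eE derh (ltn0Sn _) (lie_chain_basis U Z i j) nz).
  exact: eigenvect_lie.
move=> [|l] [|l'] // _ _ <- /esym/(chain_wt_inj a0)->//.
Qed.

Lemma typeB_mult : typeB U Z -> chain_mult n.-1.
Proof.
move=> tB i j lt_ij nz; have adB := typeB_adapted n2 dimG gen tB.
have [n5 _ _ _ _] := tB.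
have eB l : eigenvect h (chain_wtB L a b l) (chain_basisB U Z l).
  by apply: chain_basisB_eigen => //; lia.
have eE l := chain_basis_eigen l derh eU eZ.
(* The last weight is 2b + (n - 3) a, that of the bracket 2b + (i + j) a with i + j < n - 3. *)
have ne_top : chain_wtB L a b n.-1 != chain_wt a b i.+1 + chain_wt a b j.+1.
  apply/negP; rewrite /chain_wtB eqxx /= => /eqP eq_wt.
  have /(mulIf a0)/natr_inj_char0 : (n - 3)%:R * a = (i + j)%:R * a.
    apply: (addrI (b + b)); rewrite eq_wt natrD; ring.
  by lia.
have eij := eigenvect_lie derh (eE i.+1) (eE j.+1).
have [l l'|l [c [lt_l c0 eq_l wl]]] :=
  leading_inj adB eB derh (ltn0Sn _) (lie_chain_basis U Z i j) nz eij.
  have [->|ne_l] := eqVneq l n.-1; first by move=> _ _ /eqP;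
    rewrite (negPf ne_top).
  have [->|ne_l'] := eqVneq l' n.-1; first by move=> _ _ _ /eqP;
    rewrite (negPf ne_top).
  move=> lt_l lt_l'; rewrite !chain_wtBE; try lia.
  by case: l l' {ne_l ne_l'} lt_l lt_l' => [|l] [|l'] //
    _ _ <- /esym/(chain_wt_inj a0)->.
have lt_l1 : (l < n.-1)%N.
  rewrite ltn_neqAle; have [eq_l1|_] := eqVneq l n.-1; last by lia.
  by rewrite -wl eq_l1 eqxx in ne_top.
rewrite chain_wtBE // in wl; rewrite chain_basisBE // in eq_l.
by exists l, c; split=> //; lia.
Qed.

(** With Y_(i+1) for [E U Z i], the last clause is [Y_i, Y_j] = a_ij Y_(i+j+k-2); the nonzero
    bracket of neighbours makes the lambda_i not all zero. *)
Definition chain_structured N k := [/\ (2 <= k)%N, (k + 3 <= N)%N, b = k%:R * a,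
  exists2 i, (i.*2 + k.+2 < N)%N & [lie E U Z i.+1, E U Z i.+2] != 0 &
  forall i j, ((i + j).+2 < N)%N -> [lie E U Z i.+1, E U Z j.+1] = 0 \/
    ((i + j + k).+1 < N)%N /\
    exists c, [lie E U Z i.+1, E U Z j.+1] = c *: E U Z (i + j + k).+1].

(** A nonzero bracket equal to a multiple of [E U Z l] gives b = k a with k = l - 1 - i - j; as a <>
    0 in characteristic 0, [k] is the same for all brackets. *)
Lemma chain_structure N : chain_mult N ->
  (forall l, (1 < l < N)%N -> E U Z l \notin G l) ->
  (forall j, (0 < j)%N -> (j.+2 < N)%N -> kills j Z) ->
  ~ (forall i j, ((i + j).+2 < N)%N -> [lie E U Z i.+1, E U Z j.+1] = 0) ->
  exists k, chain_structured N k.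
Proof.
move=> mult G'E killZ nzero.
have [/existsP[i0 /existsP[j0 /andP[lt0 nz0]]]|/existsPn all0] := boolP
  [exists i : 'I_N, exists j : 'I_N, ((i + j).+2 < N)%N &&
    ([lie E U Z i.+1, E U Z j.+1] != 0)]; last first.
  case: nzero => i j lt_ij; have [lt_i lt_j] : (i < N)%N /\ (j < N)%N by lia.
  have /existsPn/(_ (Ordinal lt_j)) := all0 (Ordinal lt_i).
  by rewrite /= lt_ij /= negbK => /eqP.
have wtE i j l : (i + j < l)%N ->
    chain_wt a b l = chain_wt a b i.+1 + chain_wt a b j.+1 ->
    b = (l.-1 - (i + j))%:R * a.
  case: l => [//|l] le_ij /= eq_wt; rewrite natrB // mulrBl natrD.
  apply: (addrI (b + i%:R * a + j%:R * a)).
  by transitivity (b + l%:R * a); [rewrite eq_wt; ring | ring].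
have [l0 [c0 [lt_l0 c0_neq0 _ wt0]]] := mult _ _ lt0 nz0.
set k := (l0.-1 - (i0 + j0))%N.
have bE : b = k%:R * a by apply: wtE wt0; lia.
have struct i j : ((i + j).+2 < N)%N -> [lie E U Z i.+1, E U Z j.+1] != 0 ->
    ((i + j + k).+1 < N)%N /\ exists2 c, c != 0 &
    [lie E U Z i.+1, E U Z j.+1] = c *: E U Z (i + j + k).+1.
  move=> lt_ij nz; have [l [c [lt_l c_neq0 eqB wt]]] := mult _ _ lt_ij nz.
  have lt_ijl : (i + j < l)%N by lia.
  have := wtE _ _ _ lt_ijl wt; rewrite bE => /(mulIf a0)/natr_inj_char0 kE.
  have -> : (i + j + k).+1 = l by lia.
  by split; [lia | exists c].
have k1 : (1 <= k)%N by rewrite /k; lia.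
have k2 : (2 <= k)%N.
  (* If k = 1, a nonzero bracket of [Z] with the chain would go down exactly one step, which [Z]
     kills. So all brackets with [Z] vanish, and by the recursion on the first index all others
     too. *)
  rewrite ltn_neqAle k1 andbT; apply/negP => /eqP eqk.
  have brZ j : (j.+2 < N)%N -> [lie E U Z 1, E U Z j.+1] = 0.
    case: j => [|j] lt_j; first exact: liexx.
    have [//|nz] := eqVneq [lie E U Z 1, E U Z j.+2] 0.
    have [_ [c c_neq0 eqB]] := struct 0%N j.+1 lt_j nz.
    have := killZ j.+1 isT lt_j _ (chain_basis_lc U Z _).
    rewrite [[lie Z, _]]eqB -eqk add0n addn1 => /(memvZ c^-1).
    rewrite scalerA mulVf // scale1r; have lt_j3 : (1 < j.+3 < N)%N by lia.
    by move=> GE; have := G'E _ lt_j3; rewrite GE.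
  case: nzero => i; elim: i => [|i IHi] j lt_ij; first exact: brZ.
  by rewrite lie_chain_basisS !IHi ?lie0r ?subr0 //; lia.
have [/existsP[i1 /andP[lt1 nz1]]|/existsPn all0] := boolP
  [exists i : 'I_N, ((i + i.+1).+2 < N)%N && ([lie E U Z i.+1, E U Z i.+2] !=
    0)].
  have [lt_i1 _] := struct _ _ lt1 nz1.
  exists k; split=> //; [by lia | by exists i1 => //; lia | move=> i j lt_ij].
  have [->|/(struct _ _ lt_ij)[lt_k [c _ eqB]]] :=
    eqVneq [lie E U Z i.+1, E U Z j.+1] 0.
    by left.
  by right; split=> //; exists c.
case: nzero.
have adj i : ((i + i.+1).+2 < N)%N -> [lie E U Z i.+1, E U Z i.+2] = 0.
  move=> lt_i; have lt_iN : (i < N)%N by lia.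
  by have := all0 (Ordinal lt_iN); rewrite /= lt_i /= negbK => /eqP.
(* If neighbours commute, the recursion expresses gap d + 2 by the gaps d and d + 1, so every
   bracket vanishes. *)
have gap d i : ((i + (i + d)).+2 < N)%N -> [lie E U Z i.+1, E U Z (i + d).+1] =
  0.
  elim/ltn_ind: d i => -[|[|d]] IHd i lt_i; first by rewrite addn0 liexx.
    by rewrite addn1 in lt_i *; apply: adj.
  have := lie_chain_basisS U Z i (i + d.+1); rewrite (IHd d.+1) //; last by lia.
  have -> : [lie E U Z i.+2, E U Z (i + d.+1).+1] = 0.
    by rewrite -addSnnS IHd //; lia.
  by rewrite lie0r sub0r -addnS => /esym/eqP; rewrite oppr_eq0 => /eqP.
move=> i j lt_ij; have [le_ij|/ltnW le_ji] := leqP i j.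
  by have := gap (j - i)%N i; rewrite subnKC //; apply.
rewrite lieC; have := gap (i - j)%N j; rewrite subnKC // addnC => ->;
  rewrite ?oppr0 //.
Qed.

End ChainStructure.

Section StructureConstantsOfBasis.
Variables (K : fieldType) (L : lieAlgType K).
Local Notation n := (\dim {:L}).
Variable E : nat -> L.
Hypothesis basE : basis_of fullv [seq E i | i <- iota 0 n].

Let X : n.-tuple L := basis_tuple E.
Let basX : basis_of fullv X := basis_tupleP basE.

Definition basis_table (i j : 'I_n) : 'rV[K]_n := rVof X [lie E i, E j].

(** Transport through coordinates: the Jacobi identity of the table and the isomorphism with L both
    rest on it. *)
Lemma sc_bracket_table u v :
  sc_bracket basis_table u v = rVof X [lie vecof X u, vecof X v].
Proof.
rewrite /vecof lie_suml linear_sum; apply: eq_bigr => i _.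
rewrite lie_sumr linear_sum; apply: eq_bigr => j _.
by rewrite lieZl lieZr scalerA linearZ /= !nth_basis_tuple.
Qed.

Lemma basis_table_diag i : basis_table i i = 0.
Proof. by rewrite /basis_table liexx linear0. Qed.

Lemma basis_table_anti i j : basis_table j i = - basis_table i j.
Proof. by rewrite /basis_table lieC linearN. Qed.

Lemma basis_table_jacobi i j l :
    sc_bracket basis_table (delta_mx 0 i) (basis_table j l)
    + sc_bracket basis_table (delta_mx 0 j) (basis_table l i)
    + sc_bracket basis_table (delta_mx 0 l) (basis_table i j) = 0.
Proof.
rewrite !sc_bracket_table !vecof_delta !nth_basis_tuple !rVofK //.
by rewrite -!linearD lie_jacobi linear0.
Qed.

Definition basis_lieConst : lieConst K n :=
  LieConst basis_table_diag basis_table_anti basis_table_jacobi.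

Lemma basis_isomorphic : isomorphic L (lie_of basis_lieConst).
Proof.
exists (linfun (rVof X : L -> lie_of basis_lieConst)); split.
  exists (vecof X : lie_of basis_lieConst -> L) => x; rewrite lfunE /=.
    exact: rVofK.
  exact: vecofK.
move=> x y; rewrite !lfunE /=.
by rewrite [RHS]sc_bracket_table !rVofK.
Qed.

Definition basis_coord (m : nat) (x : L) : K :=
  if insub m is Some i then coord X i x else 0.

Lemma basis_coordN m x : basis_coord m (- x) = - basis_coord m x.
Proof. by rewrite /basis_coord; case: insub => [i|];
  rewrite ?linearN ?oppr0. Qed.

Lemma basis_coordD m x y :
  basis_coord m (x + y) = basis_coord m x + basis_coord m y.
Proof. by rewrite /basis_coord; case: insub => [i|];
  rewrite ?linearD ?addr0. Qed.

Lemma basis_coordZ m c x : basis_coord m (c *: x) = c * basis_coord m x.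
Proof. by rewrite /basis_coord; case: insub => [i|];
  rewrite ?linearZ ?mulr0. Qed.

Lemma basis_coord0 m : basis_coord m 0 = 0.
Proof. by rewrite /basis_coord; case: insub => [i|]; rewrite ?linear0. Qed.

Lemma basis_coordE m : (m < n)%N -> basis_coord m (E m) = 1.
Proof.
move=> lt_m; rewrite /basis_coord insubT.
have <- : X`_(Ordinal lt_m) = E m by rewrite nth_basis_tuple.
by rewrite coord_free ?eqxx // (basis_free basX).
Qed.

Lemma rVof_basis m : (m < n)%N -> rVof X (E m) = Y m.+1.
Proof.
move=> lt_m; have <- : X`_(Ordinal lt_m) = E m by rewrite nth_basis_tuple.
by rewrite rVofE //; apply/rowP => j; rewrite !mxE eqxx.
Qed.

End StructureConstantsOfBasis.

Section Families.
#[local] Arguments chain_basis : simpl never.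
#[local] Arguments basis_tuple : simpl never.
Variables (K : fieldType) (L : lieAlgType K).
Local Notation G := (lower_central L).
Local Notation n := (\dim {:L}).
Local Notation E := (@chain_basis K L).

Hypothesis charK : [pchar K] =i pred0.
Hypothesis n2 : (2 <= n)%N.
Hypothesis dimG : forall m, (0 < m)%N -> \dim (G m) = (n - 1 - m)%N.

Variables (a b : K) (U Z : L).
Hypothesis gen : generates_mod_lc U Z.

(** [al i j] is the coordinate of [Y_i, Y_j] on Y_(i+j+k-2), and the relation between the constants
    is [lie_chain_basisS] read in one coordinate. [B] agrees with the chain below [N], which covers
    both types. *)
Lemma chain_constants (B : nat -> L) N k : (N <= n)%N ->
  basis_of fullv [seq B i | i <- iota 0 n] ->
  (forall l, (l < N)%N -> B l = E U Z l) ->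
  chain_structured a b U Z N k ->
  exists al : nat -> nat -> K,
  [/\ forall i j, al j i = - al i j,
      forall i j, (2 <= i)%N -> (2 <= j)%N -> (i + j.+1 + k - 2 <= N)%N ->
        al i j = al i j.+1 + al i.+1 j,
      forall i j, ((i + j).+2 < N)%N ->
        rVof (basis_tuple B) [lie E U Z i.+1, E U Z j.+1] =
        if (i.+2 + j.+2 + k - 2 <= N)%N then al i.+2 j.+2 *: Y (i.+2 + j.+2 + k
          - 2)
        else 0 &
      exists2 i, (2 <= i)%N && (i.*2 + k <= N.+1)%N & al i i.+1 != 0].
Proof.
move=> leN basB BE [k2 kN bE [i0 lt_i0 nz0] struct].
(* [B] and [E] are numbered from 0 and the Y_i from 1, hence i + j + k - 3 and the predecessors. *)
pose al i j := basis_coord B (i + j + k - 3) [lie E U Z i.-1, E U Z j.-1].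
have coE l : (l < N)%N -> basis_coord B l (E U Z l) = 1.
  by move=> lt_l; rewrite -BE // basis_coordE //; apply: leq_trans leN.
have idx i j : (i.+2 + j.+2 + k - 3 = (i + j + k).+1)%N by lia.
exists al; split.
- move=> i j; rewrite /al lieC basis_coordN; congr (- basis_coord _ _ _); lia.
- move=> [|[|i]] [|[|j]] // _ _ le_ij.
  have lt_ij : ((i + j).+2 < N)%N by lia.
  rewrite /al idx (_ : (i.+2 + j.+3 + k - 3 = (i + j + k).+2)%N); last by lia.
  rewrite (_ : (i.+3 + j.+2 + k - 3 = (i + j + k).+2)%N); last by lia.
  rewrite -basis_coordD (lie_chain_basisS U Z i j) addrC subrK.
  case: (struct _ _ lt_ij) => [->|[lt_k [c ->]]].
    by rewrite lie0r !basis_coord0.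
  rewrite lieZr -chain_basisS !basis_coordZ !coE //; lia.
- move=> i j lt_ij;
  rewrite /al idx (_ : (i.+2 + j.+2 + k - 2 = (i + j + k).+2)%N); last by lia.
  rewrite /=; case: (struct _ _ lt_ij) => [->|[lt_k [c ->]]].
    by rewrite linear0 basis_coord0 scale0r if_same.
  rewrite lt_k linearZ /= -BE // rVof_basis //; last by apply: leq_trans leN.
  by rewrite basis_coordZ BE // coE // mulr1.
exists i0.+2; first by lia.
rewrite /al idx /=; have lt0 : ((i0 + i0.+1).+2 < N)%N by lia.
case: (struct _ _ lt0) nz0 => [->|[lt_k [c ->]]]; first by rewrite eqxx.
rewrite scaler_eq0 negb_or basis_coordZ => /andP[c0 _].
by rewrite coE // mulr1.
Qed.

Lemma mem_mktuple_nat (T : nat -> K) m i (lt_i : (i < m)%N) :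
  T i \in [tuple T j | j < m].
Proof. by apply/tnthP; exists (Ordinal lt_i); rewrite tnth_mktuple. Qed.

Lemma typeA_family k : typeA U Z -> chain_structured a b U Z n k ->
  exists (lam : (A_t n k - 1).-tuple K) (c : lieConst K n),
    is_A k lam c /\ isomorphic L (lie_of c).
Proof.
move=> tA cs; have [k2 kn _ _ _] := cs.
have basE := adapted_basis n2 dimG (typeA_adapted n2 dimG gen tA).
have [al [alN alS alE [i0 /andP[le2 lt0] nz0]]] :=
  chain_constants (leqnn _) basE (fun _ _ => erefl) cs.
(* Entry j is lambda_(j+1) = a_(j+2, j+3). *)
exists [tuple al j.+2 j.+3 | j < A_t n k - 1], (basis_lieConst basE).
split; last exact: basis_isomorphic.
have At_half : (A_t n k = (n - k + 1)./2)%N by [].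
split; first by lia.
  exists (al i0 i0.+1) => //; case: i0 le2 lt0 {nz0} => [|[|i0]] // _ lt0.
  by apply: (@mem_mktuple_nat (fun j => al j.+2 j.+3)); lia.
exists al; split=> //.
  move=> [|[|i]] // /andP[_ le_i]; have lt_i : (i < A_t n k - 1)%N by lia.
  by rewrite !subSS subn0 (nth_mktuple _ _ (Ordinal lt_i)).
move=> i j; rewrite /= /basis_table /A_bracket.
have topE := chain_basis_top n2 dimG U Z.
case: i j => [[|i] lt_i] [[|j] lt_j] /=.
- by rewrite liexx linear0.
- rewrite -(chain_basisS U Z j).
  case: ifP => lt_j1; first by rewrite rVof_basis //; lia.
  by rewrite topE ?linear0 //; lia.
- rewrite lieC linearN /= -(chain_basisS U Z i).
  case: ifP => lt_i1; first by rewrite rVof_basis //; lia.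
  by rewrite topE ?linear0 ?oppr0 //; lia.
have [lt_ij|le_ij] := ltnP (i + j).+2 n; first exact: alE.
rewrite (lc_top n2 dimG le_ij (lie_chain_basis U Z i j)) linear0.
by case: ifP => //; lia.
Qed.

(** As [U] kills step n - 3, the recursion alternates signs, starting from the normalization of the
    last vector. *)
Lemma typeB_top i j : typeB U Z -> (i + j).+3 = n ->
  [lie E U Z i.+1, E U Z j.+1] = (-1) ^+ i.+1 *: chain_basisB U Z n.-1.
Proof.
case=> n5 _ _ kU _; elim: i j => [|i IHi] j eq_n.
  rewrite /chain_basisB eqxx expr1 scaleN1r opprK.
  by rewrite (_ : n.-2 = j.+1) //; lia.
rewrite lie_chain_basisS (IHi j.+1); last by lia.
rewrite (@lc_top _ _ n2 dimG [lie U, _] (n - 3).+2); first last.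
- by apply: kU; rewrite (_ : (n - 3 = (i + j).+1)%N);
  [apply: lie_chain_basis | lia].
- by lia.
by rewrite sub0r -scaleNr [in RHS]exprS mulN1r.
Qed.

(** For n odd, [typeB_top] would give the same sign to [Y_2, Y_(n-1)] and [Y_(n-1), Y_2], against
    antisymmetry. *)
Lemma typeB_even : typeB U Z -> ~~ odd n.
Proof.
move=> tB; have [n5 _ _ _ _] := tB; apply/negP => odd_n.
have basE := adapted_basis n2 dimG (typeB_adapted n2 dimG gen tB).
have lt_n1 : (n.-1 < n)%N by lia.
have E0 := basis_neq0 basE lt_n1.
have eq1 : (0 + (n - 3)).+3 = n by lia.
have eq2 : (n - 3 + 0).+3 = n by lia.
have := typeB_top tB eq2; rewrite lieC (typeB_top tB eq1).
rewrite -[(-1) ^+ (n - 3).+1]signr_odd.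
rewrite (_ : odd (n - 3).+1 = true); last by lia.
rewrite !expr1 !scaleN1r opprK => /eqP; rewrite -addr_eq0 -mulr2n -scaler_nat.
by rewrite scaler_eq0 (negPf E0) orbF ((pcharf0P K).1 charK).
Qed.

Lemma typeB_family k : typeB U Z -> chain_structured a b U Z n.-1 k ->
  exists (lam : (B_t n k - 1).-tuple K) (c : lieConst K n),
    is_B k lam c /\ isomorphic L (lie_of c).
Proof.
move=> tB cs; have [k2 kn _ _ _] := cs; have [n5 _ _ kU _] := tB.
have adB := typeB_adapted n2 dimG gen tB; have [_ GB _] := adB.
have basE := adapted_basis n2 dimG adB.
have [al [alN alS alE [i0 /andP[le2 lt0] nz0]]] :=
  chain_constants (leq_pred _) basE (@chain_basisBE _ _ U Z) cs.
exists [tuple al j.+2 j.+3 | j < B_t n k - 1], (basis_lieConst basE).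
split; last exact: basis_isomorphic.
have Bt_half : (B_t n k = (n - k)./2)%N by [].
split; [exact: typeB_even | by lia | |].
  exists (al i0 i0.+1) => //; case: i0 le2 lt0 {nz0} => [|[|i0]] // _ lt0.
  by apply: (@mem_mktuple_nat (fun j => al j.+2 j.+3)); lia.
exists al; split=> //.
- move=> [|[|i]] // /andP[_ le_i]; have lt_i : (i < B_t n k - 1)%N by lia.
  by rewrite !subSS subn0 (nth_mktuple _ _ (Ordinal lt_i)).
- by move=> i j i2 j2 le_ij; apply: alS => //; lia.
have n1E : (n.-1).+1 = n by lia.
have lie_top x : [lie x, chain_basisB U Z n.-1] = 0.
  have := lie_lcS x (GB n.-2); rewrite (_ : n.-2.+1 = n.-1); last by lia.
  by apply: lc_top => //; lia.
(* The chain stops at Y_(n-1): [U] kills step n - 3, and Y_n is central. *)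
have lieU j : (j.+1 < n)%N -> rVof (basis_tuple (chain_basisB U Z)) [lie U,
  chain_basisB U Z j.+1] =
    if (j.+2 <= n - 2)%N then Y j.+3 else 0.
  move=> lt_j; have [le_j|gt_j] := leqP j.+2 (n - 2).
    rewrite chain_basisBE -?chain_basisS; last by lia.
    by rewrite -chain_basisBE ?rVof_basis //; lia.
  have [eq_j|ne_j] := eqVneq j.+1 n.-1; first by rewrite eq_j lie_top linear0.
  rewrite chain_basisBE; last by lia.
  rewrite (@lc_top _ _ n2 dimG [lie U, _] (n - 3).+2) ?linear0 //; first by lia.
  by apply: kU; rewrite (_ : j = n - 3)%N; [apply: chain_basis_lc | lia].
have U0 : chain_basisB U Z 0 = U by rewrite chain_basisBE //; lia.
move=> [i lt_i] [j lt_j]; rewrite /B_bracket.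
rewrite [LHS](_ : _ = rVof (basis_tuple (chain_basisB U Z))
  [lie chain_basisB U Z i, chain_basisB U Z j]) // ![nat_of_ord _]/=.
case: i lt_i => [|i] lt_i.
  rewrite eqxx; case: j lt_j => [|j] lt_j; first by rewrite liexx linear0.
  by rewrite U0 lieU.
have neq1 l : (l.+2 == 1)%N = false by [].
rewrite neq1; case: j lt_j => [|j] lt_j.
  by rewrite eqxx U0 lieC linearN /= lieU //; case: ifP; rewrite ?oppr0.
rewrite neq1.
have [eq_i|ne_i] := eqVneq i.+1 n.-1.
  rewrite eq_i lieC lie_top oppr0 linear0.
  by rewrite !ifF //; lia.
have [eq_j|ne_j] := eqVneq j.+1 n.-1.
  rewrite eq_j lie_top linear0.
  by rewrite !ifF //; lia.
rewrite !chain_basisBE; try lia.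
case: eqP => [eq_ij|ne_ij].
  rewrite typeB_top //; last by lia.
  by rewrite linearZ /= rVof_basis ?n1E // !exprS !mulN1r opprK.
have [lt_ij|le_ij] := ltnP (i + j).+2 n.-1; first by rewrite alE // subn1.
rewrite (@lc_top _ _ n2 dimG _ _ _ (lie_chain_basis U Z i j)) ?linear0 //;
  last by lia.
by rewrite ifF //; lia.
Qed.

End Families.

(** * Rank-one filiform algebras: weights and conclusion *)

Section RankOne.
Variables (K : fieldType) (L : lieAlgType K).
Local Notation G := (lower_central L).
Local Notation n := (\dim {:L}).

Hypothesis charK : [pchar K] =i pred0.

Lemma scale_natr_neq0 (a : K) i : a != 0 -> (0 < i)%N -> i%:R * a != 0.
Proof.
by move=> a0 i0; rewrite mulf_neq0 // ((pcharf0P K).1 charK) -lt0n.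
Qed.

Lemma chain_wtE (a b : K) k i : b = k%:R * a ->
  chain_wt a b i = (if i is j.+1 then (k + j)%N else 1%N)%:R * a.
Proof. by move=> ->; case: i => [|i] /=; rewrite ?mul1r // natrD mulrDl. Qed.

(** In units of a the weights are 1, k, ..., k + n - 3 and 2k + n - 3, distinct and positive once k
    >= 2. *)
Lemma chain_wtBnE (a b : K) k i : (3 <= n)%N -> b = k%:R * a ->
  chain_wtB L a b i = (if i == n.-1 then (k + k + (n - 3))%N
    else if i is j.+1 then (k + j)%N else 1%N)%:R * a.
Proof.
move=> n3 bE; rewrite /chain_wtB; case: eqP => _; last exact: chain_wtE.
by rewrite bE !natrD !mulrDl.
Qed.

Lemma rank1_filiform (t : torus L) : filiform L -> maximal_torus t ->
  \dim t = 1%N ->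
  complete (semidirect t) /\
  ((exists k (lam : (A_t n k - 1).-tuple K) (c : lieConst K n),
     is_A k lam c /\ isomorphic L (lie_of c)) \/
   (exists k (lam : (B_t n k - 1).-tuple K) (c : lieConst K n),
     is_B k lam c /\ isomorphic L (lie_of c))).
Proof.
move=> filL maxt dimt; have [n2 [dimG [Y surjY]]] := filiform_flag filL.
have n0 : (0 < n)%N by apply: ltnW.
have nokY m : (0 < m)%N -> (m.+2 < n)%N -> ~ kills m Y.
  by move=> m0 lt_m; exact: (surj_nokill n2 dimG m0 lt_m (surjY m m0)).
pose h := vpick (torus_space t);
  have th : h \in torus_space t by apply: memv_pick.
have h0 : h != 0 by rewrite vpick0 -dimv_eq0 dimt.
have derh : is_derivation h := torus_der th.
have [U [Z [a [b [eU eZ gen tAB]]]]] :=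
  adapted_pair charK n2 dimG nokY derh (torus_diag th).
case: tAB => [tA|tB].
  have a0 := typeA_wt_neq0 n2 dimG maxt dimt th h0 eU eZ gen tA.
  have adE := typeA_adapted n2 dimG gen tA; have basE :=
    adapted_basis n2 dimG adE.
  have [kZ nkU] := tA; have [_ _ G'E] := adE.
  have [|l lt_l|j j0 _|br0|k cs] := @chain_structure _ _ charK n2 a b U Z a0 n.
  - exact: typeA_mult.
  - by case: l lt_l => [|l] // /andP[l1 lt_l]; apply: G'E.
  - exact: kZ.
  (* Brackets with i + j + 2 >= n vanish by depth, so the vanishing below [N] would give the full
     model. *)
  - apply: (typeA_not_Ln n2 dimG maxt dimt th h0 eU eZ gen tA) => i j.
    have [/br0 //|le_n] := ltnP (i + j).+2 n.
    exact: (lc_top n2 dimG le_n (lie_chain_basis U Z i j)).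
  have [k2 _ bE _ _] := cs; split; last first.
    by left; exists k; exact: (typeA_family n2 dimG gen tA cs).
  apply: (semidirect_complete basE maxt dimt th n0 (wt := chain_wt a b)).
  - by move=> i _; apply: chain_basis_eigen.
  - move=> i _; rewrite (chain_wtE _ bE) scale_natr_neq0 //; case: i => // i;
    lia.
  move=> i j _ _; rewrite !(chain_wtE _ bE) =>
    /(mulIf a0)/(natr_inj_char0 charK).
  by case: i j => [|i] [|j]; lia.
have a0 := typeB_wt_neq0 n2 dimG charK maxt dimt th h0 eU eZ gen tB.
have adE := typeB_adapted n2 dimG gen tB; have basE :=
  adapted_basis n2 dimG adE.
have [n5 kZ nkU _ _] := tB.
have n3 : (3 <= n)%N by lia.
have [|l lt_l|j j0 lt_j|br0|k cs] :=
  @chain_structure _ _ charK n2 a b U Z a0 n.-1.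
- exact: typeB_mult.
- by case: l lt_l => [|l] // lt_l; apply: typeB_chain => //; lia.
- by apply: kZ => //; lia.
- by apply: (typeB_not_Qn n2 dimG maxt dimt th h0 eU eZ gen tB) => i j lt_ij;
  apply: br0; lia.
have [k2 kn bE _ _] := cs; split; last first.
  by right; exists k; exact: (typeB_family charK n2 dimG gen tB cs).
apply: (semidirect_complete basE maxt dimt th n0 (wt := chain_wtB L a b)).
- by move=> i _; apply: chain_basisB_eigen.
- move=> i _; rewrite (chain_wtBnE _ n3 bE) scale_natr_neq0 //.
  by case: eqP => _; [lia | case: i => // i; lia].
move=> i j lt_i lt_j; rewrite !(chain_wtBnE _ n3 bE) =>
  /(mulIf a0)/(natr_inj_char0 charK).
by case: eqP => ei; case: eqP => ej; case: i j lt_i lt_j ei ej => [|i] [|j];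
  lia.
Qed.

End RankOne.

Local Close Scope ring_scope.

Theorem theorem4 (R : realType) (L : lieAlgType R[i]) (hfil : filiform L)
    (hrank : has_rank L 1) :
  completable L <->
  (exists (k : nat) (lam : (A_t (\dim {:L}) k - 1).-tuple R[i])
          (c : lieConst R[i] (\dim {:L})),
     is_A k lam c /\ isomorphic L (lie_of c)) \/
  (exists (k : nat) (lam : (B_t (\dim {:L}) k - 1).-tuple R[i])
          (c : lieConst R[i] (\dim {:L})),
     is_B k lam c /\ isomorphic L (lie_of c)).
Proof.
case: hrank => t maxt dimt.
have [compl fam] := rank1_filiform (@Num.Theory.pchar_num _) hfil maxt dimt.
by split=> // _; exists t.
Qed.
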